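(* Let $K_1(z,w)=\sum_{k=0}^\infty a_k(z\bar w)^k$ and $K_2(z,w)=\sum_{k=0}^\infty b_k(z\bar w)^k$ be any two reproducing kernels on the open unit disc $\mathbb D$ such that $\{a_k\}_{k\geq 0}$ and $\{b_k\}_{k\geq 0}$ are completely alternating sequences. Then the multiplication operator $M_z$ on $\mathcal H(K_1+K_2)$ is subnormal.
   Context: $\mathbb D=\{z\in\mathbb C:|z|<1\}$. A sequence $\{a_k\}_{k\geq 0}$ of positive real numbers is completely alternating if $\sum_{j=0}^n(-1)^j\binom{n}{j}a_{m+j}\leq 0$ for all $m\geq 0$, $n\geq 1$. For a positive definite kernel $K$ on $\mathbb D$ (holomorphic in the first variable and anti-holomorphic in the second), $\mathcal H(K)$ denotes the reproducing kernel Hilbert space of holomorphic functions on $\mathbb D$ with reproducing kernel $K$, and $M_z$ denotes the operator of multiplication by the coordinate function, $(M_zf)(z)=zf(z)$. A bounded operator $T$ on a Hilbert space $\mathcal H$ is subnormal if there are a Hilbert space $\mathcal K\supset\mathcal H$ and a bounded normal operator $N$ on $\mathcal K$ with $N(\mathcal H)\subset\mathcal H$ and $N|_{\mathcal H}=T$. *)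

(* Defs.v *)
From HB Require Import structures.
From mathcomp Require Import all_boot all_order all_algebra.
From mathcomp Require Import complex.
From mathcomp Require Import all_classical all_reals all_analysis.

Set Implicit Arguments.
Unset Strict Implicit.
Unset Printing Implicit Defensive.

Import Order.TTheory GRing.Theory Num.Theory.
Import numFieldNormedType.Exports.

Local Open Scope classical_set_scope.
Local Open Scope ring_scope.
Local Open Scope complex_scope.

(* The usual topology and norm on R[i], inherited from the regular module. *)
HB.instance Definition _ (R : rcfType) := NormedModule.copy R[i] R[i]^o.

(* The norm of a normed module over R[i] takes its values in R[i] (in the
   nonnegative reals); Num.conj is complex conjugation.  The inner product is
   linear in its first argument. *)
Record hilbertSpace (R : realType) := HilbertSpace {
  hilbert_sort :> completeNormedModType R[i];
  inner : {dot hilbert_sort for (@Num.conj R[i])};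
  inner_norm : forall x : hilbert_sort, `|x| ^+ 2 = inner x x }.

Section operators.
Context {R : realType}.

Definition bounded_op (H : hilbertSpace R) (T : {linear H -> H}) : Prop :=
  exists M : R, forall x : H, `|T x| <= M%:C * `|x|.

Definition adjoint_op (H : hilbertSpace R) (T S : {linear H -> H}) : Prop :=
  forall x y : H, inner H (T x) y = inner H x (S y).

(* The adjoint of a bounded operator is unique, so the quantifier over S only
   names it. *)
Definition normal_op (H : hilbertSpace R) (N : {linear H -> H}) : Prop :=
  bounded_op N /\
  exists S : {linear H -> H},
    [/\ bounded_op S, adjoint_op N S & forall x : H, N (S x) = S (N x)].

(* The inclusion of H in the larger space is the isometric embedding V; the
   equation N (V x) = V (T x) says both that V(H) is invariant under N and that
   N restricts to T on it. *)
Definition subnormal (H : hilbertSpace R) (T : {linear H -> H}) : Prop :=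
  bounded_op T /\
  exists (K : hilbertSpace R) (V : {linear H -> K}) (N : {linear K -> K}),
    [/\ forall x y : H, inner K (V x) (V y) = inner H x y,
        normal_op N
      & forall x : H, N (V x) = V (T x)].

End operators.

Section kernels.
Context {R : realType}.

Definition unit_disc : set R[i] := [set z | `|z| < 1].

Definition holomorphic_disc (f : R[i] -> R[i]) : Prop :=
  forall z : R[i], unit_disc z -> derivable f z 1.

Definition positive_definite (K : R[i] -> R[i] -> R[i]) : Prop :=
  forall (n : nat) (z c : 'I_n -> R[i]),
    (forall i, unit_disc (z i)) ->
    0 <= \sum_(i < n) \sum_(j < n) c i * Num.conj (c j) * K (z i) (z j).

Definition reproducing_kernel (K : R[i] -> R[i] -> R[i]) : Prop :=
  [/\ positive_definite K,
      forall w, unit_disc w -> holomorphic_disc (fun z => K z w)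
    & forall z, unit_disc z -> holomorphic_disc (fun w => Num.conj (K z w))].

(* K(z, w) = \sum_k a_k (z \bar w)^k on the disc, convergence included. *)
Definition diagonal_expansion (a : nat -> R) (K : R[i] -> R[i] -> R[i]) : Prop :=
  forall z w : R[i], unit_disc z -> unit_disc w ->
    series (fun k => (a k)%:C * (z * Num.conj w) ^+ k) @ \oo --> K z w.

Definition completely_alternating (a : nat -> R) : Prop :=
  (forall k, 0 < a k) /\
  forall m n : nat, (1 <= n)%N ->
    \sum_(j < n.+1) (-1) ^+ j * 'C(n, j)%:R * a (m + j)%N <= 0.

(* The reproducing kernel Hilbert space H(K): a Hilbert space whose elements
   are, through fun_of, holomorphic functions on the disc.  A function on the
   disc is represented by a function on R[i] whose values outside the disc are
   irrelevant; fun_of_inj says that a vector is determined by its values on the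
   disc.  Such a space is unique up to the unitary that preserves these
   values. *)
Record rkhs (K : R[i] -> R[i] -> R[i]) := Rkhs {
  rkhs_space :> hilbertSpace R;
  fun_of : rkhs_space -> R[i] -> R[i];
  fun_of_linear : forall (a : R[i]) (f g : rkhs_space) (z : R[i]),
    unit_disc z -> fun_of (a *: f + g) z = a * fun_of f z + fun_of g z;
  fun_of_inj : forall f g : rkhs_space,
    (forall z, unit_disc z -> fun_of f z = fun_of g z) -> f = g;
  fun_of_holomorphic : forall f : rkhs_space, holomorphic_disc (fun_of f);
  rkhs_reproducing : forall w : R[i], unit_disc w ->
    exists k : rkhs_space,
      (forall z, unit_disc z -> fun_of k z = K z w) /\
      forall f : rkhs_space, fun_of f w = inner rkhs_space f k }.

Definition is_mult_z (K : R[i] -> R[i] -> R[i]) (H : rkhs K)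
    (T : {linear H -> H}) : Prop :=
  forall (f : H) (z : R[i]), unit_disc z -> fun_of (T f) z = z * fun_of f z.

End kernels.

(* Main.v *)
Require Import Defs.
From HB Require Import structures.
From mathcomp Require Import all_boot all_order all_algebra.
From mathcomp Require Import complex.
From mathcomp Require Import all_classical all_reals all_analysis.
From mathcomp Require Import ring lra zify.

(** Put [c k = a k + b k].  Complete alternation is preserved by sums, so only
    [c] matters.  In the space with kernel [\sum_k c k (z conj w)^k] the
    monomials are orthogonal and total, with [||z^k||^2 = 1 / c k], so [M_z] is
    a weighted shift.  Leibniz's rule applied to [c * (1 / c) = 1] shows that
    [g = 1 / c] is completely monotone ([completely_monotone_inv]).  By
    Hausdorff, [g k] is then the [k]-th moment of a measure on [[0, 1]]; lifted
    to a rotation-invariant measure on the closed disc, this turns [M_z] into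
    the restriction of multiplication by [z] on an [L^2] space, which is normal.

    The proof keeps the idea but builds neither the measure nor its [L^2]
    space.  Of the latter only the Gram matrix of the functions
    [z^i (conj z)^j] is needed, namely [g (i + l)] when [i + l = k + j] and [0]
    otherwise, at the indices [(i, j)] and [(k, l)]; this is [moment_kernel].
    Its positivity, and the positivity of its decrease under [(i, j) -> (i+1, j)],
    follow from Bernstein's approximation of [g] by moments of finitely
    supported measures ([psd_moment_kernel]).

    A positive matrix on a countable set is the Gram matrix of vectors in any
    Hilbert space that contains an orthonormal sequence: its Cholesky factor
    has finitely many entries in each row ([cholesky], [gram_vectors]).  Hence
    [H] itself can serve as the larger Hilbert space.  Bounded operators are
    obtained by prescribing them on a family with dense span and comparing Gram
    matrices ([extend_contraction], [gram_contraction]); this yields [M_z], the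
    isometry of [H] onto the closed span of the vectors with [j = 0], and, from
    the two shifts of the index set, the normal operator and its adjoint
    ([normal_of_commuting_shifts]).

    The remaining point is that an abstract reproducing kernel space with the
    given kernel contains the monomials and is spanned by them.  The monomial
    [z^n] is the limit as [t -> 0] of the suitably scaled difference of the
    kernel function at [t] and its projection on the lower monomials
    ([monomial_step]). *)

Set Implicit Arguments.
Unset Strict Implicit.
Unset Printing Implicit Defensive.

Import Order.TTheory GRing.Theory Num.Theory.
Import numFieldNormedType.Exports.

Local Open Scope ring_scope.
Local Open Scope complex_scope.

(** * Differences and completely monotone sequences *)

Section sequences.
Variable R : realType.
Implicit Types u v c g : nat -> R.

Definition altdiff u : nat -> R := fun m => u m - u m.+1.

Definition completely_monotone g := forall n m, 0 <= iter n altdiff g m.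

Lemma pascal_sum (V : nmodType) (F : nat -> V) n :
  \sum_(j < n.+2) F j *+ 'C(n.+1, j) =
  \sum_(j < n.+1) F j *+ 'C(n, j) + \sum_(j < n.+1) F j.+1 *+ 'C(n, j).
Proof.
rewrite big_ord_recl /= bin0 mulr1n.
under eq_bigr => j _ do rewrite /= /bump /= add1n binS mulrnDr.
rewrite big_split /= addrA; congr (_ + _).
rewrite big_ord_recr /= bin_small // mulr0n addr0.
by rewrite [RHS]big_ord_recl /= bin0.
Qed.

Lemma iter_diffS u n m :
  iter n.+1 altdiff u m = iter n altdiff u m - iter n altdiff u m.+1.
Proof. by []. Qed.

Lemma iter_diffD u v n m :
  iter n altdiff (fun k => u k + v k) m = iter n altdiff u m + iter n altdiff v m.
Proof. by elim: n m => [//|n IHn] m; rewrite !iter_diffS !IHn; ring. Qed.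

Lemma iter_diff_shift u n m :
  iter n altdiff (fun k => u k.+1) m = iter n altdiff u m.+1.
Proof. by elim: n m => [//|n IHn] m; rewrite !iter_diffS !IHn. Qed.

Lemma eq_iter_diff u v n m : u =1 v -> iter n altdiff u m = iter n altdiff v m.
Proof. by move=> uv; elim: n m => [|n IHn] m; rewrite ?iter_diffS ?IHn /=. Qed.

Lemma iter_diffE u n m :
  iter n altdiff u m = \sum_(j < n.+1) (-1) ^+ j * 'C(n, j)%:R * u (m + j)%N.
Proof.
elim: n m => [|n IHn] m.
  by rewrite big_ord1 bin0 expr0 !mul1r addn0.
rewrite iter_diffS !IHn.
pose F m j := (-1) ^+ j * u (m + j)%N.
have E k i : \sum_(j < k.+1) (-1) ^+ j * 'C(k, j)%:R * u (i + j)%N =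
  \sum_(j < k.+1) F i j *+ 'C(k, j).
  by apply: eq_bigr => j _; rewrite /F -[RHS]mulr_natr mulrAC.
rewrite !E pascal_sum; congr (_ + _).
rewrite -sumrN; apply: eq_bigr => j _.
by rewrite /F exprS addSnnS mulN1r mulNr mulNrn.
Qed.

Lemma iter_diffM u v n m :
  iter n altdiff (fun k => u k * v k) m =
  \sum_(j < n.+1) (iter j altdiff u m * iter (n - j) altdiff v (m + j)%N) *+ 'C(n, j).
Proof.
elim: n u v m => [|n IHn] u v m; first by rewrite big_ord1 addn0.
rewrite iterSr.
rewrite (@eq_iter_diff _ (fun k => u k * altdiff v k + altdiff u k * v k.+1)); last first.
  by move=> k; rewrite /altdiff; ring.
rewrite iter_diffD !IHn (pascal_sum (fun j => iter j altdiff u m *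
  iter (n.+1 - j) altdiff v (m + j)%N)); congr (_ + _); apply: eq_bigr => j _.
  by rewrite -iterSr subSn // -ltnS.
by rewrite iter_diff_shift -iterSr subSS addnS.
Qed.

(** Leibniz's rule applied to [c * (1 / c) = 1]: the term in which no
    difference falls on [c] is [c] times the difference sought, and all the
    others are products of a nonpositive and a nonnegative factor. *)
Lemma completely_monotone_inv c :
  (forall k, 0 < c k) -> (forall n m, iter n.+1 altdiff c m <= 0) ->
  completely_monotone (fun k => (c k)^-1).
Proof.
move=> c_gt0 c_alt; elim/ltn_ind => -[|n] IHn m.
  by rewrite /= invr_ge0 ltW.
have D1 : iter n.+1 altdiff (fun k => c k * (c k)^-1) m = 0.
  rewrite (@eq_iter_diff _ (fun=> 1)); last by move=> k; rewrite divff ?gt_eqF.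
  elim: n {IHn} m => [|n IHn] m; first by rewrite /altdiff /= subrr.
  by rewrite iter_diffS !IHn subrr.
move: D1; rewrite iter_diffM big_ord_recl bin0 mulr1n subn0 addn0 [iter 0 _ _ _]/=.
move=> /eqP; rewrite addr_eq0 => /eqP E.
rewrite -(pmulr_rge0 _ (c_gt0 m)) E oppr_ge0.
apply: sumr_le0 => j _; rewrite mulrn_wle0 //.
apply: mulr_le0_ge0; first exact: c_alt.
by apply: IHn; rewrite /= /bump /= add1n subSS ltnS leq_subr.
Qed.

Lemma completely_monotone_diff g :
  completely_monotone g -> completely_monotone (altdiff g).
Proof. by move=> g_mono n m; rewrite -iterSr; apply: g_mono. Qed.

(** This expands [1 = (altdiff + shift)^N], two commuting operators on
    sequences whose sum is the identity. *)
Lemma bernstein_partition g N m :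
  g m = \sum_(j < N.+1) iter (N - j) altdiff g (m + j)%N *+ 'C(N, j).
Proof.
elim: N g m => [|N IHN] g m; first by rewrite big_ord1 addn0.
rewrite (pascal_sum (fun j => iter (N.+1 - j) altdiff g (m + j)%N)).
rewrite -[LHS](subrK (g m.+1)); congr (_ + _).
  rewrite -/(altdiff g m) IHN; apply: eq_bigr => j _.
  by rewrite subSn ?iterSr // -ltnS.
by rewrite IHN; apply: eq_bigr => j _; rewrite subSS addnS.
Qed.

Lemma ffact_bin n m k : (m <= k)%N -> (k <= n)%N ->
  ('C(n - m, k - m) * n ^_ m = 'C(n, k) * k ^_ m)%N.
Proof.
move=> mk kn; apply/eqP; rewrite -(eqn_pmul2r (fact_gt0 (k - m))); apply/eqP.
rewrite mulnAC bin_ffact -mulnA ffact_fact // bin_ffact mulnC.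
elim: m mk => [|m IHm] mk; first by rewrite ffactn0 mul1n !subn0.
rewrite -(IHm (ltnW mk)) ffactnSr -mulnA; congr (_ * _)%N.
rewrite -[in RHS](subnSK mk) ffactnS; congr (_ * _ ^_ _)%N.
by rewrite subnS.
Qed.

(** The mass at [k / n] of the discrete measure that approximates the measure
    with moments [g]. *)
Definition bernstein_weight g n k : R := iter (n - k) altdiff g k *+ 'C(n, k).

Lemma bernstein_weight_sum g n : \sum_(k < n.+1) bernstein_weight g n k = g 0.
Proof.
rewrite [RHS](bernstein_partition g n); apply: eq_bigr => k _.
by rewrite add0n.
Qed.

(** The identity of [bernstein_partition] at order [n - m], with its binomial
    coefficients written relative to those of order [n]: [g m] is an average of
    the ratios of falling factorials, which are close to [(k / n)^m]. *)
Lemma bernstein_ffact g n m : (m <= n)%N ->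
  g m = \sum_(k < n.+1) (k ^_ m)%:R / (n ^_ m)%:R * bernstein_weight g n k.
Proof.
move=> mn; rewrite (bernstein_partition g (n - m)).
rewrite -(big_mkord xpredT
  (fun k => (k ^_ m)%:R / (n ^_ m)%:R * bernstein_weight g n k)).
rewrite (@big_cat_nat _ _ _ m) ?leqW //.
rewrite [X in _ = X + _]big_nat_cond big1 ?add0r; last first.
  by move=> k /andP[/andP[_ km] _]; rewrite ffact_small // !mul0r.
rewrite [RHS](@big_addn _ _ _ 0 n.+1 m) subSn // big_mkord; apply: eq_bigr => j _.
have jn : (j + m <= n)%N by have := ltn_ord j; lia.
have := ffact_bin (leq_addl j m) jn; rewrite addnK => E.
have n0 : (n ^_ m)%:R != 0 :> R by rewrite pnatr_eq0 -lt0n ffact_gt0.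
have EC : 'C(n - m, j)%:R = 'C(n, j + m)%:R * ((j + m) ^_ m)%:R / (n ^_ m)%:R :> R.
  by rewrite -natrM -E natrM mulfK.
rewrite /bernstein_weight [(m + j)%N]addnC (_ : n - m - j = n - (j + m))%N; last by lia.
rewrite -[LHS]mulr_natr EC -[X in _ = _ * X]mulr_natr.
set A := iter _ _ _ _; move: A => A; move: (_ ^_ _)%:R 'C(_, _)%:R => K C.
ring.
Qed.

(** Both terms are products of [m] factors in [[0, 1]]; the factors
    [(k - i) / (n - i)] and [k / n] differ by at most [i / n].  Truncated
    subtraction keeps the factors in [[0, 1]] also when [k < i]. *)
Lemma ffact_ratio_bound n m k : (m <= n)%N -> (k <= n)%N ->
  `|(k ^_ m)%:R / (n ^_ m)%:R - (k%:R / n%:R) ^+ m| <= (m ^ 2)%:R / n%:R :> R.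
Proof.
move=> + kn; elim: m => [|m IHm] mn.
  by rewrite !ffactn0 expr0 divr1 subrr normr0 mul0r.
have n_gt0 : (0 < n)%N by apply: leq_trans mn.
have nR : 0 < n%:R :> R by rewrite ltr0n.
pose r : R := (k - m)%:R / (n - m)%:R; pose x : R := k%:R / n%:R.
have nm : 0 < (n - m)%:R :> R by rewrite ltr0n subn_gt0.
have r0 : 0 <= r by rewrite divr_ge0.
have r1 : r <= 1 by rewrite ler_pdivrMr // mul1r ler_nat leq_sub2r.
have x0 : 0 <= x by rewrite divr_ge0.
have x1 : x <= 1 by rewrite ler_pdivrMr // mul1r ler_nat.
have rx : `|r - x| <= m%:R / n%:R.
  rewrite ler_pdivlMr // -[X in _ * X]ger0_norm ?ler0n // -normrM.
  have [mk|/ltnW km] := leqP m k; last first.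
    rewrite /r (_ : (k - m = 0)%N); last by apply/eqP; rewrite subn_eq0.
    rewrite mul0r sub0r mulNr normrN mulfVK ?gt_eqF // ger0_norm ?ler0n //.
    by rewrite ler_nat.
  have -> : (r - x) * n%:R = - (m%:R * ((n - k)%:R / (n - m)%:R)).
    have E a b : (a <= b)%N -> (b - a)%:R = b%:R - a%:R :> R by move/natrB->.
    move: nm; rewrite /r /x (E _ _ mk) (E _ _ kn) (E _ _ (ltnW mn)).
    move: (k%:R) (m%:R) nR; move: (n%:R) => a b c a_gt0 ac_gt0.
    by field; rewrite !gt_eqF.
  rewrite normrN ger0_norm; last by rewrite mulr_ge0 ?divr_ge0.
  rewrite ler_piMr ?ler0n // ler_pdivrMr // mul1r ler_nat.
  by rewrite leq_sub2l.
rewrite !ffactnSr (natrM _ (k ^_ m)) (natrM _ (n ^_ m)) -mulf_div exprSr -/r -/x.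
set p := (k ^_ m)%:R / (n ^_ m)%:R; have := IHm (ltnW mn); rewrite -/p -/x => pm.
have -> : p * r - x ^+ m * x = (p - x ^+ m) * r + x ^+ m * (r - x) by ring.
apply: le_trans (ler_normD _ _) _.
rewrite (normrM _ r) (normrM (x ^+ m)).
apply: (@le_trans _ _ ((m ^ 2)%:R / n%:R * 1 + 1 * (m%:R / n%:R))).
  apply: lerD; apply: ler_pM; rewrite ?normr_ge0 ?(ger0_norm r0) //.
  by rewrite normrX exprn_ile1 // ger0_norm.
rewrite mulr1 mul1r -mulrDl ler_pM2r ?invr_gt0 // -natrD ler_nat.
by rewrite -!mulnn; nia.
Qed.

Definition bernstein_moment g n m : R :=
  \sum_(k < n.+1) bernstein_weight g n k * (k%:R / n%:R) ^+ m.

Lemma bernstein_weight_ge0 g n k :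
  completely_monotone g -> 0 <= bernstein_weight g n k.
Proof. by move=> g_mono; rewrite mulrn_wge0. Qed.

Lemma bernstein_moment_bound g n m : completely_monotone g -> (m <= n)%N ->
  `|g m - bernstein_moment g n m| <= g 0 * (m ^ 2)%:R / n%:R.
Proof.
move=> g_mono mn; rewrite {1}(bernstein_ffact g mn) -sumrB.
apply: le_trans (ler_norm_sum _ _ _) _.
rewrite -(bernstein_weight_sum g n) !mulr_suml; apply: ler_sum => k _.
rewrite [X in X - _]mulrC -mulrBr normrM ger0_norm ?bernstein_weight_ge0 //.
rewrite -mulrA ler_wpM2l ?bernstein_weight_ge0 //.
by rewrite ffact_ratio_bound // -ltnS.
Qed.

End sequences.
Arguments altdiff {R} u m.

(** * Positive semidefinite kernels *)

Section psd_kernels.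
Variable R : realType.

Definition psd_kernel (I : Type) (G : I -> I -> R) :=
  forall s : seq (R * I),
    0 <= \sum_(p <- s) \sum_(q <- s) p.1 * q.1 * G p.2 q.2.

(** The quadratic form is a sum, over the values of [d], of squares. *)
Lemma psd_diagonal_blocks (I D : eqType) (d : I -> D) (w : I -> R) :
  psd_kernel (fun i j => (w i * w j) *+ (d i == d j)).
Proof.
move=> s; pose r := undup [seq d p.2 | p <- s].
pose y (p : R * I) := p.1 * w p.2.
have -> : \sum_(p <- s) \sum_(q <- s)
    p.1 * q.1 * (w p.2 * w q.2 *+ (d p.2 == d q.2)) =
  \sum_(e <- r) (\sum_(p <- s) y p *+ (d p.2 == e)) ^+ 2.
  under [RHS]eq_bigr => e _.
    rewrite expr2 big_distrlr /=; over.
  rewrite [RHS]exchange_big /=; apply: eq_big_seq => p ps.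
  rewrite [RHS]exchange_big /=; apply: eq_big_seq => q qs.
  rewrite (bigD1_seq (d p.2)) ?undup_uniq //=; last first.
    by rewrite mem_undup; apply: map_f.
  rewrite eqxx mulr1n big1 ?addr0; last first.
    by move=> e /negPf; rewrite eq_sym => ->; rewrite mulr0n mul0r.
  rewrite -!mulrnAr [d q.2 == _]eq_sym /y; ring.
by apply: sumr_ge0 => e _; apply: sqr_ge0.
Qed.

(** The Gram matrix of the functions [z ^ i * conj z ^ j] in the [L^2] space of
    a rotation-invariant measure whose radial moments are [g]. *)
Definition moment_kernel (g : nat -> R) (i j : nat * nat) : R :=
  g (i.1 + j.2)%N *+ (i.1 + j.2 == j.1 + i.2)%N.

Lemma moment_kernel_sym (g : nat -> R) i j : moment_kernel g i j = moment_kernel g j i.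
Proof. by rewrite /moment_kernel eq_sym; case: eqP => [->|_] //; rewrite !mulr0n. Qed.

(** For the moments [r^(2 m)] of a point mass the kernel is
    [r^(i + j) * r^(k + l)] on the blocks where [i - j] is constant, hence
    positive by [psd_diagonal_blocks].  Bernstein's measures are positive
    combinations of point masses with [r^2 = k / n], and their moments converge
    to [g] with an error of order [1 / n]. *)
Lemma psd_moment_kernel g :
  completely_monotone g -> psd_kernel (moment_kernel g).
Proof.
move=> g_mono s.
pose form h := \sum_(p <- s) \sum_(q <- s) p.1 * q.1 * moment_kernel h p.2 q.2.
have form_ge0 n : 0 <= form (bernstein_moment g n).
  pose D := fun i : nat * nat => i.1%:Z - i.2%:Z.
  pose w k := fun i : nat * nat => Num.sqrt (k%:R / n%:R) ^+ (i.1 + i.2) : R.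
  have -> : form (bernstein_moment g n) = \sum_(k < n.+1) bernstein_weight g n k *
      \sum_(p <- s) \sum_(q <- s)
        p.1 * q.1 * ((w k p.2 * w k q.2) *+ (D p.2 == D q.2)).
    under [RHS]eq_bigr do rewrite mulr_sumr.
    rewrite [RHS]exchange_big /=; apply: eq_bigr => -[x [i1 i2]] _.
    under [RHS]eq_bigr do rewrite mulr_sumr.
    rewrite [RHS]exchange_big /=; apply: eq_bigr => -[y [j1 j2]] _.
    rewrite /moment_kernel /D /=.
    have -> : (i1%:Z - i2%:Z == j1%:Z - j2%:Z) = (i1 + j2 == j1 + i2)%N.
      by apply/eqP/eqP; lia.
    have [e|_] := eqVneq; last first.
      by rewrite mulr0n mulr0 big1 // => k _; rewrite mulr0.
    rewrite mulr1n /bernstein_moment mulr_sumr; apply: eq_bigr => k _.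
    rewrite mulr1n /w /= -exprD (_ : i1 + i2 + (j1 + j2) = 2 * (i1 + j2))%N; last by lia.
    by rewrite exprM sqr_sqrtr ?divr_ge0 // mulrCA.
  apply: sumr_ge0 => k _; rewrite mulr_ge0 ?bernstein_weight_ge0 //.
  exact: psd_diagonal_blocks.
pose C := \sum_(p <- s) \sum_(q <- s)
  `|p.1 * q.1| * (g 0 * ((p.2.1 + q.2.2) ^ 2)%:R).
(* [B] only has to dominate every order of moment that occurs in the form. *)
pose B := \sum_(p <- s) \sum_(q <- s) (p.2.1 + q.2.2)%N.
have form_close n : (B <= n)%N -> `|form g - form (bernstein_moment g n)| <= C / n%:R.
  move=> Bn; rewrite -sumrB mulr_suml; apply: le_trans (ler_norm_sum _ _ _) _.
  rewrite big_seq [leRHS]big_seq; apply: ler_sum => p ps.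
  rewrite -sumrB mulr_suml; apply: le_trans (ler_norm_sum _ _ _) _.
  rewrite big_seq [leRHS]big_seq; apply: ler_sum => q qs.
  rewrite -mulrBr normrM -mulrA ler_wpM2l // /moment_kernel -mulrnBl.
  have mn : (p.2.1 + q.2.2 <= n)%N.
    apply: leq_trans Bn; rewrite /B (big_rem p) //= (big_rem q) //=; lia.
  have bound := bernstein_moment_bound g_mono mn.
  case: (_ == _); first by rewrite mulr1n.
  by rewrite mulr0n normr0; apply: le_trans bound.
have bound n : (B <= n)%N -> (0 < n)%N -> - form g * n%:R <= C.
  move=> Bn n_gt0; rewrite -ler_pdivlMr ?ltr0n //.
  have := form_close _ Bn; rewrite ler_norml => /andP[lb _].
  by have := form_ge0 n; lra.
have C_ge0 : 0 <= C.
  apply: sumr_ge0 => p _; apply: sumr_ge0 => q _.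
  by rewrite !mulr_ge0 // (g_mono 0%N).
rewrite -oppr_le0 leNgt -/(form g); apply/negP => f_lt0.
have := archi_boundP (divr_ge0 C_ge0 (ltW f_lt0)); set N := Num.bound _ => CN.
have := bound (N + B).+1 (leqW (leq_addl _ _)) isT.
rewrite -ler_pdivlMl // mulrC leNgt => /negP[]; apply: lt_le_trans CN _.
by rewrite ler_nat -addnS leq_addr.
Qed.

Lemma psd_comp (I J : Type) (f : J -> I) (G : I -> I -> R) :
  psd_kernel G -> psd_kernel (fun i j => G (f i) (f j)).
Proof.
move=> G_psd s; have := G_psd [seq (p.1, f p.2) | p <- s].
by rewrite big_map; under eq_bigr do rewrite big_map.
Qed.

Section cholesky.
Variables (I : Type) (G : I -> I -> R).
Hypothesis G_sym : forall i j, G i j = G j i.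
Hypothesis G_psd : psd_kernel G.

Lemma psd_kernel_ge0 i : 0 <= G i i.
Proof. by have := G_psd [:: (1, i)]; rewrite !big_seq1 !mul1r. Qed.

(** Otherwise the form on [(x, i), (1, j)] would be affine in [x] with nonzero
    slope, hence negative somewhere. *)
Lemma psd_kernel_null i j : G i i = 0 -> G i j = 0.
Proof.
move=> Gii; have [//|Gij] := eqVneq (G i j) 0; exfalso.
have := G_psd [:: (- (G j j + 1) / (2 * G i j), i); (1, j)].
rewrite !big_cons !big_nil /= Gii [G j i]G_sym.
set f := (X in 0 <= X); suff -> : f = -1 by rewrite oppr_ge0 ler10.
by rewrite /f; field.
Qed.

(** When the pivot vanishes, [1 / 0 = 0] makes this the kernel itself, which is
    the right value by [psd_kernel_null]. *)
Definition schur_complement n i j : R := G i j - G i n * G j n / G n n.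

(** The form of the Schur complement at [s] is the form of [G] at [s] extended
    by the multiple of the index [n] that minimizes it. *)
Lemma psd_schur_complement n : psd_kernel (schur_complement n).
Proof.
have [Gnn s|Gnn s] := eqVneq (G n n) 0.
  rewrite /schur_complement Gnn invr0.
  under eq_bigr do under eq_bigr do rewrite mulr0 subr0.
  exact: G_psd.
pose t := \sum_(p <- s) p.1 * G p.2 n.
have := G_psd ((- t / G n n, n) :: s); rewrite !big_cons /=.
under [X in _ <= _ + X -> _]eq_bigr do rewrite big_cons /=.
rewrite big_split /=.
have -> : \sum_(q <- s) - t / G n n * q.1 * G n q.2 = - t / G n n * t.
  by rewrite mulr_sumr; apply: eq_bigr => q _; rewrite mulrA (G_sym n q.2).
have -> : \sum_(q <- s) q.1 * (- t / G n n) * G q.2 n = - t / G n n * t.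
  by rewrite mulr_sumr; apply: eq_bigr => q _; rewrite mulrAC mulrC.
suff -> : \sum_(p <- s) \sum_(q <- s) p.1 * q.1 * schur_complement n p.2 q.2 =
  \sum_(p <- s) \sum_(q <- s) p.1 * q.1 * G p.2 q.2 - t * t / G n n.
  apply: etrans; congr (0 <= _); by field.
rewrite /t big_distrlr /= mulr_suml -sumrB; apply: eq_bigr => p _.
rewrite mulr_suml -sumrB; apply: eq_bigr => q _.
by rewrite /schur_complement; ring.
Qed.

End cholesky.

Fixpoint schur (G : nat -> nat -> R) n : nat -> nat -> R :=
  if n is m.+1 then schur_complement (schur G m) m else G.

(** Gaussian elimination without pivoting.  Zero pivots are allowed: the
    matching column of the factor is then zero, as the middle conclusion says. *)
Lemma cholesky (G : nat -> nat -> R) :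
  (forall i j, G i j = G j i) -> psd_kernel G ->
  exists L : nat -> nat -> R,
    [/\ forall i k, (i < k)%N -> L i k = 0,
        forall k, L k k = 0 -> forall i, L i k = 0
      & forall i j n, (i < n)%N -> G i j = \sum_(k < n) L i k * L j k].
Proof.
move=> G_sym G_psd.
have [S_sym S_psd] : (forall n i j, schur G n i j = schur G n j i) /\
    (forall n, psd_kernel (schur G n)).
  suff H n : (forall i j, schur G n i j = schur G n j i) /\ psd_kernel (schur G n).
    by split=> n; have [] := H n.
  elim: n => [//|n [IHs IHp]]; split; last exact: psd_schur_complement.
  by move=> i j; rewrite /= /schur_complement IHs [_ i n * _]mulrC.
have S_null n i j : (i < n)%N -> schur G n i j = 0.
  elim: n i j => [//|n IHn] i j; rewrite ltnS leq_eqVlt => /predU1P[->|i_lt_n] /=.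
    rewrite /schur_complement; have [Snn|Snn] := eqVneq (schur G n n n) 0.
      by rewrite !(psd_kernel_null (S_sym n) (S_psd n) _ Snn) !mul0r subrr.
    by rewrite mulrAC divff // mul1r [schur G n j n]S_sym subrr.
  by rewrite /schur_complement !(IHn i) // !mul0r subrr.
pose L i k := schur G k i k / Num.sqrt (schur G k k k).
have LL i j k : L i k * L j k = schur G k i j - schur G k.+1 i j.
  rewrite /L mulf_div -expr2 sqr_sqrtr ?psd_kernel_ge0 //=.
  by rewrite /schur_complement opprB addrC subrK.
exists L; split=> [i k ik|k Lk i|i j n i_lt_n].
- by rewrite /L S_null // mul0r.
- have := LL k k k; rewrite Lk mulr0 (S_null k.+1) // subr0 => S0.
  by rewrite /L -S0 sqrtr0 invr0 mulr0.
- under eq_bigr do rewrite LL.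
  rewrite -(big_mkord xpredT (fun k => schur G k i j - schur G k.+1 i j)).
  under eq_bigr do rewrite -opprB.
  by rewrite sumrN telescope_sumr // opprB (S_null n) // subr0.
Qed.

End psd_kernels.

(** * Real-valued norms and inner products *)

Section complex_modulus.
Variable R : realType.

(** Norms over [R[i]] take values in [R[i]], whose order is partial; the real
    value is needed for arithmetic on the totally ordered field [R]. *)
Definition rnorm (V : normedModType R[i]) (x : V) : R := complex.Re `|x|.

Lemma rnormE (V : normedModType R[i]) (x : V) : `|x| = (rnorm x)%:C.
Proof. by rewrite /rnorm RRe_real // normr_real. Qed.

Lemma rnorm_ge0 (V : normedModType R[i]) (x : V) : 0 <= rnorm x.
Proof. by rewrite -ler0c -rnormE normr_ge0. Qed.

Lemma rnormD (V : normedModType R[i]) (x y : V) :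
  rnorm (x + y) <= rnorm x + rnorm y.
Proof. by rewrite -lecR rmorphD /= -!rnormE ler_normD. Qed.

Lemma rnormN (V : normedModType R[i]) (x : V) : rnorm (- x) = rnorm x.
Proof. by rewrite /rnorm normrN. Qed.

Lemma rnormB (V : normedModType R[i]) (x y : V) :
  rnorm (x - y) <= rnorm x + rnorm y.
Proof. by rewrite -(rnormN y) rnormD. Qed.

Lemma rnorm_distC (V : normedModType R[i]) (x y : V) :
  rnorm (x - y) = rnorm (y - x).
Proof. by rewrite -rnormN opprB. Qed.

Lemma rnormZ (V : normedModType R[i]) (a : R[i]) (x : V) :
  rnorm (a *: x) = rnorm a * rnorm x.
Proof. by apply: complexI; rewrite rmorphM /= -!rnormE normrZ. Qed.

Lemma rnormM (a b : R[i]) : rnorm (a * b) = rnorm a * rnorm b.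
Proof. by apply: complexI; rewrite rmorphM /= -!rnormE normrM. Qed.

Lemma rnorm0 (V : normedModType R[i]) : rnorm (0 : V) = 0.
Proof. by rewrite /rnorm normr0. Qed.

Lemma rnorm_le0_eq0 (V : normedModType R[i]) (x : V) : rnorm x <= 0 -> x = 0.
Proof.
move=> x0; apply/normr0_eq0; rewrite rnormE; congr _%:C.
by apply/eqP; rewrite eq_le x0 rnorm_ge0.
Qed.

Lemma rnorm_real (x : R) : rnorm (x%:C : R[i]) = `|x|.
Proof. by apply: complexI; rewrite -rnormE normc_def /= expr0n addr0 sqrtr_sqr. Qed.

Lemma rnorm_conj (a : R[i]) : rnorm (Num.conj a) = rnorm a.
Proof. by rewrite /rnorm norm_conjC. Qed.

Lemma rnorm_sqr (a : R[i]) : ((rnorm a) ^+ 2)%:C = a * Num.conj a.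
Proof. by rewrite rmorphXn /= -rnormE normCK. Qed.

Lemma conj_real (x : R) : Num.conj (x%:C : R[i]) = x%:C.
Proof. by apply: conj_Creal; rewrite complex_real. Qed.

End complex_modulus.

Section hilbert.
Variable R : realType.
Variable H : hilbertSpace R.
Local Notation C := R[i].
Implicit Types x y z : H.

Local Notation "''[' x , y ]" := (inner H x y) : ring_scope.

Lemma inner_conj x y : Num.conj '[x, y] = '[y, x].
Proof. by rewrite [RHS]hermC expr0 mul1r. Qed.

Lemma innerDl x y z : '[x + y, z] = '[x, z] + '[y, z].
Proof. by rewrite linearDl. Qed.
Lemma innerBl x y z : '[x - y, z] = '[x, z] - '[y, z].
Proof. by rewrite linearBl. Qed.
Lemma innerZl a x y : '[a *: x, y] = a * '[x, y].
Proof. by rewrite linearZl_LR. Qed.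
Lemma inner0l x : '[0, x] = 0.
Proof. by rewrite linear0l. Qed.
Lemma inner0r x : '[x, 0] = 0.
Proof. by rewrite linear0r. Qed.
Lemma innerDr x y z : '[z, x + y] = '[z, x] + '[z, y].
Proof. by rewrite linearDr. Qed.
Lemma innerBr x y z : '[z, x - y] = '[z, x] - '[z, y].
Proof. by rewrite linearBr. Qed.
Lemma innerZr a x y : '[x, a *: y] = Num.conj a * '[x, y].
Proof. by rewrite linearZr_LR. Qed.
Lemma inner_suml I (r : seq I) (P : pred I) (F : I -> H) y :
  '[\sum_(i <- r | P i) F i, y] = \sum_(i <- r | P i) '[F i, y].
Proof. by rewrite linear_sumlz. Qed.
Lemma inner_sumr I (r : seq I) (P : pred I) (F : I -> H) y :
  '[y, \sum_(i <- r | P i) F i] = \sum_(i <- r | P i) '[y, F i].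
Proof. by rewrite linear_sumr. Qed.

Lemma inner_rnorm x : '[x, x] = ((rnorm x) ^+ 2)%:C.
Proof. by rewrite rmorphXn /= -rnormE inner_norm. Qed.

Lemma cauchy_schwarz x y : rnorm '[x, y] <= rnorm x * rnorm y.
Proof.
have [y0|y0] := eqVneq (rnorm y) 0.
  rewrite (_ : y = 0) ?inner0r ?rnorm0 ?mulr0 //.
  by apply: rnorm_le0_eq0; rewrite y0.
have yC : (rnorm y)%:C != 0 :> C by rewrite fmorph_eq0.
pose a := '[x, y] / '[y, y].
have : 0 <= '[x - a *: y, x - a *: y] by rewrite inner_rnorm ler0c sqr_ge0.
have -> : '[x - a *: y, x - a *: y] =
    ((rnorm x) ^+ 2 - (rnorm '[x, y] / rnorm y) ^+ 2)%:C.
  rewrite innerBl !innerBr !innerZl !innerZr -[ '[y, x]]inner_conj /a.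
  rewrite rmorphM /= fmorphV /= !inner_rnorm conj_real.
  rewrite rmorphB /= exprMn exprVn [(_ / _)%:C]rmorphM /= fmorphV /= rnorm_sqr !rmorphXn /=.
  by field.
rewrite ler0c subr_ge0 ler_sqr ?nnegrE ?divr_ge0 ?rnorm_ge0 //.
by rewrite ler_pdivrMr // lt_def y0 rnorm_ge0.
Qed.

End hilbert.

Section sequences_in_hilbert.
Variable R : realType.
Local Notation C := R[i].
Local Open Scope classical_set_scope.

(** The bound on the tail passes to the limit, which gives convergence with the
    same rate. *)
Lemma hilbert_complete (H : hilbertSpace R) (u : nat -> H) (d : nat -> R) :
  d @ \oo --> (0 : R) ->
  (forall m n, (m <= n)%N -> rnorm (u n - u m) ^+ 2 <= d m) ->
  exists l : H, forall m, rnorm (l - u m) ^+ 2 <= d m.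
Proof.
move=> d0 ud.
have d_ge0 m : 0 <= d m by apply: le_trans (ud m m (leqnn m)); rewrite sqr_ge0.
have u_close e : 0 < e -> \forall n & m \near \oo, rnorm (u n - u m) < e.
  move=> e_gt0; have e2 : 0 < e ^+ 2 by rewrite exprn_gt0.
  have [N _ dN] := cvgr0_norm_lt _ d0 _ e2.
  have {}ud m n : (N <= m)%N -> (m <= n)%N -> rnorm (u n - u m) < e.
    move=> Nm mn; rewrite -ltr_sqr ?nnegrE ?rnorm_ge0 ?ltW //.
    apply: le_lt_trans (ud _ _ mn) _; rewrite -(ger0_norm (d_ge0 m)).
    exact: dN.
  exists ([set n | (N <= n)%N], [set n | (N <= n)%N]).
    by split; exists N.
  move=> [n m] /= [Nn Nm]; have [mn|/ltnW nm] := leqP m n; first exact: ud.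
  by rewrite rnorm_distC; apply: ud.
have /cauchy_cvgP/cvg_ex[l ul] : cauchy (u @ \oo).
  apply/cauchy_ballP => e e_gt0; near_simpl.
  have e_real : e = (complex.Re e)%:C by rewrite RRe_real // gtr0_real.
  have := u_close (complex.Re e); rewrite -ltcR -e_real => /(_ e_gt0).
  apply: filterS => -[n m] /=; rewrite -ball_normE /ball_ /= rnormE => nm.
  by rewrite e_real ltcR.
exists l => m.
suff lm : rnorm (l - u m) <= Num.sqrt (d m).
  by rewrite -[leRHS]sqr_sqrtr ?ler_sqr ?nnegrE ?rnorm_ge0 ?sqrtr_ge0.
apply/ler_addgt0Pl => e e_gt0.
have eC : 0 < e%:C :> C by rewrite ltcR.
have [N _ lN] : \forall n \near \oo, `|l - u n| < e%:C by apply: cvgr_dist_lt.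
have := lN (maxn N m) (leq_maxl _ _); rewrite /= rnormE ltcR => lu.
rewrite -(subrKA (u (maxn N m))); apply: le_trans (rnormD _ _) _.
rewrite lerD ?(ltW lu) //.
rewrite -ler_sqr ?nnegrE ?rnorm_ge0 ?sqrtr_ge0 // sqr_sqrtr //.
by rewrite ud ?leq_maxr.
Unshelve. all: by end_near. Qed.

End sequences_in_hilbert.

(** * Finite combinations and Gram matrices *)

Section combinations.
Variable R : realType.
Local Notation C := R[i].

Definition comb (V : lmodType C) (I : Type) (u : I -> V) (s : seq (C * I)) : V :=
  \sum_(p <- s) p.1 *: u p.2.

Lemma comb_cat (V : lmodType C) I (u : I -> V) s t :
  comb u (s ++ t) = comb u s + comb u t.
Proof. by rewrite /comb big_cat. Qed.

Lemma comb_scale (V : lmodType C) I (u : I -> V) a s :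
  comb u [seq (a * p.1, p.2) | p <- s] = a *: comb u s.
Proof.
rewrite /comb big_map scaler_sumr; apply: eq_bigr => p _.
by rewrite scalerA.
Qed.

Lemma comb1 (V : lmodType C) I (u : I -> V) i : comb u [:: (1, i)] = u i.
Proof. by rewrite /comb big_seq1 scale1r. Qed.

Lemma comb_nil (V : lmodType C) I (u : I -> V) : comb u [::] = 0.
Proof. by rewrite /comb big_nil. Qed.

Lemma inner_comb (H : hilbertSpace R) I J (u : I -> H) (v : J -> H) s t :
  inner H (comb u s) (comb v t) =
  \sum_(p <- s) \sum_(q <- t) p.1 * Num.conj q.1 * inner H (u p.2) (v q.2).
Proof.
rewrite inner_suml; apply: eq_bigr => p _.
rewrite inner_sumr; apply: eq_bigr => q _.
by rewrite innerZl innerZr mulrA.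
Qed.

(** By symmetry of [G], the complex form is the sum of the real forms at the
    real and at the imaginary parts of the coefficients. *)
Lemma psd_kernel_complex I (G : I -> I -> R) (s : seq (C * I)) :
  (forall i j, G i j = G j i) -> psd_kernel G ->
  0 <= \sum_(p <- s) \sum_(q <- s) p.1 * Num.conj q.1 * (G p.2 q.2)%:C.
Proof.
move=> G_sym G_psd.
pose re (p : C * I) := (complex.Re p.1, p.2).
pose im (p : C * I) := (complex.Im p.1, p.2).
pose form (f g : C * I -> R * I) :=
  \sum_(p <- s) \sum_(q <- s) (f p).1 * (g q).1 * G p.2 q.2.
have form_ge0 f : (forall p, (f p).2 = p.2) -> 0 <= form f f.
  move=> f2; have := G_psd [seq f p | p <- s]; rewrite big_map.
  rewrite /form (eq_bigr (fun p =>
    \sum_(q <- s) (f p).1 * (f q).1 * G p.2 q.2)) // => p _.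
  by rewrite big_map; apply: eq_bigr => q _; rewrite !f2.
have -> : \sum_(p <- s) \sum_(q <- s) p.1 * Num.conj q.1 * (G p.2 q.2)%:C =
    (form re re + form im im)%:C + 'i%C * (form im re - form re im)%:C.
  rewrite /form -big_split -sumrB !rmorph_sum /= mulr_sumr -big_split /=.
  apply: eq_bigr => p _.
  rewrite -big_split -sumrB !rmorph_sum /= mulr_sumr -big_split /=.
  apply: eq_bigr => q _.
  case: p q => [[a b] i] [[c d] j] /=.
  rewrite /Num.conj /=; apply/eqP; rewrite eq_complex /=.
  by apply/andP; split; apply/eqP; ring.
have -> : form im re = form re im.
  rewrite /form exchange_big /=; apply: eq_bigr => p _; apply: eq_bigr => q _.
  by rewrite [_ * complex.Re _]mulrC G_sym.
by rewrite subrr mulr0 addr0 ler0c addr_ge0 // form_ge0.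
Qed.

Lemma gram_contraction (H K : hilbertSpace R) I (u : I -> H) (v : I -> K)
    (G G' : I -> I -> R) :
  (forall i j, G i j = G j i) -> (forall i j, G' i j = G' j i) ->
  (forall i j, inner H (u i) (u j) = (G i j)%:C) ->
  (forall i j, inner K (v i) (v j) = (G' i j)%:C) ->
  psd_kernel (fun i j => G i j - G' i j) ->
  forall s, rnorm (comb v s) <= rnorm (comb u s).
Proof.
move=> G_sym G'_sym uG vG' GG' s.
rewrite -ler_sqr ?nnegrE ?rnorm_ge0 // -lecR -!inner_rnorm !inner_comb.
rewrite -subr_ge0 -sumrB.
have -> : \sum_(p <- s) (\sum_(q <- s) p.1 * (q.1)^* * inner H (u p.2) (u q.2) -
    \sum_(q <- s) p.1 * (q.1)^* * inner K (v p.2) (v q.2)) =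
  \sum_(p <- s) \sum_(q <- s) p.1 * Num.conj q.1 * (G p.2 q.2 - G' p.2 q.2)%:C.
  apply: eq_bigr => p _; rewrite -sumrB; apply: eq_bigr => q _.
  by rewrite uG vG' -mulrBr rmorphB.
apply: (@psd_kernel_complex _ (fun i j => G i j - G' i j)) => // i j.
by rewrite G_sym G'_sym.
Qed.

End combinations.

(** * Operators prescribed on a family with dense span *)

Section dense_families.
Variable R : realType.
Local Notation C := R[i].

Definition dense_span (H : hilbertSpace R) (I : Type) (u : I -> H) : Prop :=
  forall (x : H) (e : R), 0 < e -> exists s, rnorm (x - comb u s) <= e.

Lemma dense_span_trans (H : hilbertSpace R) I J (u : I -> H) (v : J -> H) :
  dense_span u -> (forall i, exists s, u i = comb v s) -> dense_span v.
Proof.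
move=> u_dense /choice[f uf] x e /u_dense-/(_ x)[s xs].
suff [t tE] : exists t, comb v t = comb u s by exists t; rewrite tE.
elim: s {xs} => [|[a i] s [t tE]]; first by exists [::]; rewrite !comb_nil.
exists ([seq (a * p.1, p.2) | p <- f i] ++ t).
by rewrite comb_cat comb_scale -uf tE /comb big_cons.
Qed.

(** The image of [x] is the only vector that is as close to each [comb v s] as
    [x] is to [comb u s]; it exists by completeness. *)
Lemma extend_contraction (H K : hilbertSpace R) I (u : I -> H) (v : I -> K) :
  dense_span u -> (forall s, rnorm (comb v s) <= rnorm (comb u s)) ->
  exists T : {linear H -> K},
    (forall x, rnorm (T x) <= rnorm x) /\ forall i, T (u i) = v i.
Proof.
move=> u_dense vu.
have vuB s t : rnorm (comb v s - comb v t) <= rnorm (comb u s - comb u t).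
  have E (V : lmodType C) (w : I -> V) : comb w s - comb w t =
      comb w (s ++ [seq (-1 * p.1, p.2) | p <- t]).
    by rewrite comb_cat comb_scale scaleN1r.
  by rewrite !E.
have ex_image x : exists y, forall s, rnorm (y - comb v s) <= rnorm (x - comb u s).
  have eps_gt0 n : 0 < (n.+1%:R)^-1 :> R by rewrite invr_gt0 ltr0n.
  have /choice[f xf] n := u_dense x _ (eps_gt0 n).
  have f_close m n : (m <= n)%N ->
      rnorm (comb v (f n) - comb v (f m)) <= 2 * (m.+1%:R)^-1.
    move=> mn; apply: le_trans (vuB _ _) _.
    rewrite -(subrKA x) mulrDl mul1r; apply: le_trans (rnormD _ _) _.
    rewrite lerD // 1?rnorm_distC; apply: le_trans (xf _) _ => //.
    by rewrite lef_pV2 ?posrE ?ltr0n // ler_nat.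
  have [||y yf] := @hilbert_complete R K (comb v \o f)
      (fun m => (2 * (m.+1%:R)^-1) ^+ 2).
  - have -> : (0 : R) = (2 * 0) ^+ 2 by rewrite mulr0 expr0n.
    rewrite (_ : (fun m : nat => _) =
      (fun m => (2 * harmonic m) * (2 * harmonic m))); last first.
      by apply/funext => m; rewrite expr2.
    by rewrite expr2; apply: cvgM; apply: cvgMr; exact: cvg_harmonic.
  - move=> m n mn; by rewrite ler_sqr ?nnegrE ?rnorm_ge0 //; exact: f_close.
  exists y => s; apply/ler_addgt0Pl => e e_gt0.
  pose n := Num.bound (3 / e).
  have ne : 3 * (n.+1%:R)^-1 <= e.
    rewrite ler_pdivrMr ?ltr0n // mulrC -ler_pdivrMr //.
    have := archi_boundP (divr_ge0 (ler0n _ 3) (ltW e_gt0)); rewrite -/n => /ltW h.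
    by apply: le_trans h _; rewrite ler_nat.
  have yn : rnorm (y - comb v (f n)) <= 2 * (n.+1%:R)^-1.
    by rewrite -ler_sqr ?nnegrE ?rnorm_ge0 //; exact: yf.
  rewrite -(subrKA (comb v (f n))); apply: le_trans (rnormD _ _) _.
  have : rnorm (comb v (f n) - comb v s) <= (n.+1%:R)^-1 + rnorm (x - comb u s).
    apply: le_trans (vuB _ _) _; rewrite -(subrKA x).
    by apply: le_trans (rnormD _ _) _; rewrite lerD // rnorm_distC.
  by move: (n.+1%:R)^-1 (rnorm _) (rnorm _) (rnorm _) ne yn => d p q r; lra.
have [T Tx] := choice ex_image.
have T_unique x y : (forall e, 0 < e ->
    exists s, rnorm (x - comb u s) <= e /\ rnorm (y - comb v s) <= e) -> T x = y.
  move=> yx; apply/eqP; rewrite -subr_eq0; apply/eqP/rnorm_le0_eq0.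
  apply/ler_addgt0Pl => e e_gt0; rewrite addr0.
  have [//|s [xs ys]] := yx (e / 2); first by rewrite divr_gt0.
  rewrite -(subrKA (comb v s)); apply: le_trans (rnormD _ _) _.
  have := Tx x s; rewrite [rnorm (comb v s - _)]rnorm_distC.
  by lra.
have T_linear : linear T.
  move=> a x y; apply: T_unique => e e_gt0.
  have a1_gt0 : 0 < rnorm a + 1 by rewrite ltr_wpDl ?rnorm_ge0.
  have d_gt0 := divr_gt0 e_gt0 a1_gt0; set d := e / _ in d_gt0.
  have [s xs] := u_dense x _ d_gt0; have [t yt] := u_dense y _ d_gt0.
  have dE : rnorm a * d + d = e.
    by rewrite -[X in _ + X]mul1r -mulrDl mulrC divfK ?gt_eqF.
  have bound (V : normedModType C) (p q p' q' : V) :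
      rnorm (p - p') <= d -> rnorm (q - q') <= d ->
      rnorm (a *: p + q - (a *: p' + q')) <= e.
    move=> pd qd; rewrite opprD addrACA -scalerBr; apply: le_trans (rnormD _ _) _.
    by rewrite rnormZ -dE lerD // ler_wpM2l // rnorm_ge0.
  exists ([seq (a * p.1, p.2) | p <- s] ++ t); rewrite !comb_cat !comb_scale.
  by split; apply: bound => //; apply: le_trans (Tx _ _) _.
pose TL : {linear H -> K} := HB.pack T (GRing.isLinear.Build _ _ _ _ T T_linear).
exists TL; split=> [x|i].
  by have := Tx x [::]; rewrite !comb_nil !subr0.
apply: T_unique => e e_gt0; exists [:: (1, i)].
by rewrite !comb1 !subrr !rnorm0 ltW.
Qed.

Lemma dense_span_linear_eq0 (H : hilbertSpace R) (V : normedModType C) I (u : I -> H)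
    (f : H -> V) (M : R) :
  dense_span u -> linear f -> (forall x, rnorm (f x) <= M * rnorm x) ->
  (forall i, f (u i) = 0) -> forall x, f x = 0.
Proof.
move=> u_dense f_linear fM fu x.
pose fL : {linear H -> V} := HB.pack f (GRing.isLinear.Build _ _ _ _ f f_linear).
have M1_gt0 : 0 < `|M| + 1 by rewrite ltr_wpDl.
apply: rnorm_le0_eq0; apply/ler_addgt0Pl => e e_gt0; rewrite addr0.
have [s xs] := u_dense x _ (divr_gt0 e_gt0 M1_gt0).
have fs : f (comb u s) = 0.
  rewrite -[f]/(fL : H -> V) /comb linear_sum big1 // => p _.
  by rewrite linearZ /= fu scaler0.
have -> : f x = f (x - comb u s) by rewrite -[f]/(fL : H -> V) linearB /= fs subr0.
apply: le_trans (fM _) _; move: xs; rewrite ler_pdivlMr // => xs.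
apply: le_trans xs; rewrite mulrC ler_wpM2l ?rnorm_ge0 //.
by have := ler_norm M; lra.
Qed.

(** Two bounded sesquilinear forms that agree on a family with dense span are
    equal.  The shape given to the forms covers both adjunction and isometry. *)
Lemma dense_span_form_eq (H K K' : hilbertSpace R) I (u : I -> H)
    (A A' : {linear H -> K}) (B B' : {linear H -> K'}) :
  dense_span u ->
  (forall x, rnorm (A x) <= rnorm x) -> (forall x, rnorm (A' x) <= rnorm x) ->
  (forall x, rnorm (B x) <= rnorm x) -> (forall x, rnorm (B' x) <= rnorm x) ->
  (forall i j, inner K (A (u i)) (A' (u j)) = inner K' (B (u i)) (B' (u j))) ->
  forall x y, inner K (A x) (A' y) = inner K' (B x) (B' y).
Proof.
move=> u_dense A1 A'1 B1 B'1 AB.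
pose D x y := inner K (A x) (A' y) - inner K' (B x) (B' y).
have D_bound x y : rnorm (D x y) <= 2 * rnorm y * rnorm x.
  apply: le_trans (rnormB _ _) _; rewrite -mulrA mulrDl mul1r.
  by apply: lerD; apply: le_trans (cauchy_schwarz _ _) _;
    rewrite mulrC ler_pM ?rnorm_ge0.
have Dj j x : D x (u j) = 0.
  apply: (dense_span_linear_eq0 u_dense (f := D^~ (u j))) => [a y z|y|i].
  - by rewrite /D (linearP A) (linearP B) !innerDl !innerZl /GRing.scale /=; ring.
  - exact: D_bound.
  - by rewrite /D AB subrr.
move=> x y; apply/eqP; rewrite -subr_eq0 -/(D x y); apply/eqP.
rewrite -[D x y]conjCK.
rewrite (dense_span_linear_eq0 u_dense (f := fun y => Num.conj (D x y))
  (M := 2 * rnorm x)) ?conjC0 //.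
- move=> a v w; rewrite /D (linearP A') (linearP B') !innerDr !innerZr.
  rewrite !rmorphB !rmorphD !rmorphM.
  by rewrite /= !conjCK /GRing.scale /=; ring.
- by move=> w; rewrite rnorm_conj mulrAC; exact: D_bound.
- by move=> i; rewrite Dj conjC0.
Qed.

End dense_families.

(** * Orthonormal sequences and vectors with a given Gram matrix *)

Section orthonormal_sequences.
Variable R : realType.
Variable H : hilbertSpace R.
Local Notation C := R[i].
Local Notation "''[' x , y ]" := (inner H x y) : ring_scope.
Variable e : nat -> H.
Hypothesis e_on : forall m n, '[e m, e n] = (m == n)%:R.

Lemma inner_orthonormal_sum m n (c d : nat -> C) :
  '[\sum_(m <= k < n) c k *: e k, \sum_(m <= k < n) d k *: e k] =
  \sum_(m <= k < n) c k * Num.conj (d k).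
Proof.
rewrite inner_suml; apply: eq_big_nat => k kmn.
rewrite inner_sumr (bigD1_seq k) ?mem_index_iota ?iota_uniq //=.
rewrite innerZl innerZr e_on eqxx mulr1 big1 ?addr0 // => l lk.
by rewrite innerZl innerZr e_on eq_sym (negPf lk) !mulr0.
Qed.

Lemma inner_orthonormal_coef n (c : nat -> C) k : (k < n)%N ->
  '[\sum_(0 <= l < n) c l *: e l, e k] = c k.
Proof.
move=> kn; rewrite inner_suml (bigD1_seq k) ?mem_index_iota ?iota_uniq //=.
rewrite innerZl e_on eqxx mulr1 big1 ?addr0 // => l lk.
by rewrite innerZl e_on (negPf lk) mulr0.
Qed.

Local Open Scope classical_set_scope.

(** The Fourier sums of [x] converge by Bessel's inequality, and [x] minus their
    limit is orthogonal to the sequence. *)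
Lemma orthonormal_dense_span :
  (forall x, (forall k, '[x, e k] = 0) -> x = 0) -> dense_span e.
Proof.
move=> e_complete x eps eps_gt0.
pose c k := '[x, e k].
pose S n := \sum_(0 <= k < n) c k *: e k.
pose s n : R := \sum_(0 <= k < n) rnorm (c k) ^+ 2.
have sumC m n : \sum_(m <= k < n) c k * Num.conj (c k) =
    (\sum_(m <= k < n) rnorm (c k) ^+ 2)%:C.
  by rewrite rmorph_sum /=; apply: eq_bigr => k _; rewrite rnorm_sqr.
have SB m n : (m <= n)%N -> rnorm (S n - S m) ^+ 2 = s n - s m.
  move=> mn; apply: complexI; rewrite -inner_rnorm.
  have cat (V : zmodType) (f : nat -> V) :
      \sum_(0 <= k < n) f k - \sum_(0 <= k < m) f k = \sum_(m <= k < n) f k.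
    by rewrite (@big_cat_nat _ _ _ m) //= addrAC subrr add0r.
  by rewrite /S /s !cat inner_orthonormal_sum sumC.
have s_le n : s n <= rnorm x ^+ 2.
  have : 0 <= '[x - S n, x - S n] by rewrite inner_rnorm ler0c sqr_ge0.
  have xS : '[x, S n] = (s n)%:C.
    by rewrite inner_sumr -sumC; apply: eq_bigr => k _; rewrite innerZr mulrC.
  rewrite innerBl !innerBr -[ '[S n, x]]inner_conj xS conj_real.
  by rewrite inner_orthonormal_sum sumC subrr subr0 inner_rnorm -rmorphB ler0c subr_ge0.
have s_nd : nondecreasing_seq s.
  by move=> m n mn; rewrite -subr_ge0 -SB // sqr_ge0.
have s_cvg : cvgn s.
  apply: nondecreasing_is_cvgn => //.
  by exists (rnorm x ^+ 2) => _ [n _ <-].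
pose d n := limn s - s n.
have d0 : d @ \oo --> (0 : R).
  by rewrite -(subrr (limn s)); apply: cvgB => //; exact: cvg_cst.
have [||l lS] := @hilbert_complete R H S d => //.
  by move=> m n mn; rewrite SB // lerB // nondecreasing_cvgn_le.
have d_small r : 0 < r -> exists N, forall n, (N <= n)%N -> d n < r.
  move=> r_gt0; have [N _ dN] := cvgr0_norm_lt _ d0 _ r_gt0.
  by exists N => n /dN/=; apply: le_lt_trans; exact: ler_norm.
have xl : x - l = 0.
  apply: e_complete => k; apply: rnorm_le0_eq0; apply/ler_addgt0Pl => r r_gt0.
  rewrite addr0; have [N dN] := d_small _ (exprn_gt0 2 r_gt0).
  pose n := maxn N k.+1.
  have -> : '[x - l, e k] = '[S n - l, e k].
    by rewrite !innerBl inner_orthonormal_coef // leq_maxr.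
  apply: le_trans (cauchy_schwarz _ _) _.
  have -> : rnorm (e k) = 1.
    apply/eqP; rewrite -[_ == 1](@eqrXn2 _ 2) ?rnorm_ge0 // expr1n.
    by apply/eqP/complexI; rewrite -inner_rnorm e_on eqxx.
  rewrite mulr1 -ler_sqr ?nnegrE ?rnorm_ge0 ?ltW // rnorm_distC.
  by rewrite (le_lt_trans (lS n)) // dN // leq_maxl.
have [N dN] := d_small _ (exprn_gt0 2 eps_gt0).
exists [seq (c k, k) | k <- index_iota 0 N].
rewrite /comb big_map -/(S N).
rewrite -ler_sqr ?nnegrE ?rnorm_ge0 ?ltW // (subr0_eq xl).
by rewrite (le_lt_trans (lS N)) // dN.
Qed.

(** The rows of a Cholesky factor, read in the orthonormal sequence.  The
    second conclusion locates the closed span of the [v i]: it is spanned by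
    those [e k] that are not orthogonal to it, which replaces a projection
    theorem. *)
Lemma gram_vectors (G : nat -> nat -> R) :
  (forall i j, G i j = G j i) -> psd_kernel G ->
  exists v : nat -> H,
    (forall i j, '[v i, v j] = (G i j)%:C) /\
    forall k, (exists s, e k = comb v s) \/ (forall i, '[v i, e k] = 0).
Proof.
move=> G_sym G_psd; have [L [L_low L_null LG]] := cholesky G_sym G_psd.
pose v i := \sum_(0 <= k < i.+1) (L i k)%:C *: e k.
have vE i n : (i < n)%N -> v i = \sum_(0 <= k < n) (L i k)%:C *: e k.
  move=> i_lt_n; rewrite [RHS](@big_cat_nat _ _ _ i.+1) //=.
  rewrite [X in _ + X](_ : _ = 0) ?addr0 // big_nat_cond big1 //.
  by move=> k /andP[/andP[ik _] _]; rewrite L_low // scale0r.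
have ve i k : '[v i, e k] = (L i k)%:C.
  by rewrite (vE i (maxn i k).+1) ?ltnS ?leq_maxl // inner_orthonormal_coef ?ltnS ?leq_maxr.
exists v; split=> [i j|].
  pose n := (maxn i j).+1.
  rewrite (vE i n) ?ltnS ?leq_maxl // (vE j n) ?ltnS ?leq_maxr //.
  rewrite inner_orthonormal_sum (LG i j n) ?ltnS ?leq_maxl // rmorph_sum /=.
  by rewrite big_mkord; apply: eq_bigr => k _; rewrite conj_real rmorphM.
elim/ltn_ind => k IHk.
have [Lk|Lk] := eqVneq (L k k) 0; first by right=> i; rewrite ve L_null.
left; have [t tE] : exists t, comb v t = \sum_(0 <= l < k) (L k l)%:C *: e l.
  suff span_prefix m : (m <= k)%N ->
      exists t, comb v t = \sum_(0 <= l < m) (L k l)%:C *: e l.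
    exact: span_prefix.
  elim: m => [|m IHm] mk; first by exists [::]; rewrite comb_nil big_nil.
  have [t tE] := IHm (ltnW mk); rewrite big_nat_recr //= -tE.
  have [[s ->]|/(_ k)] := IHk m mk.
    by exists (t ++ [seq ((L k m)%:C * p.1, p.2) | p <- s]); rewrite comb_cat comb_scale.
  by rewrite ve => ->; exists t; rewrite scale0r addr0.
exists [seq (((L k k)^-1)%:C * p.1, p.2) | p <- (1, k) :: [seq (-1 * p.1, p.2) | p <- t]].
rewrite comb_scale -cat1s comb_cat comb1 comb_scale tE scaleN1r.
rewrite /v big_nat_recr //= addrAC subrr add0r scalerA -rmorphM mulVf //.
by rewrite scale1r.
Qed.

End orthonormal_sequences.

(** * Normal operators from commuting shifts of the indices *)

Section normal_operators.
Variable R : realType.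
Local Notation C := R[i].

Lemma contraction_bounded (H : hilbertSpace R) (T : {linear H -> H}) :
  (forall x, rnorm (T x) <= rnorm x) -> bounded_op T.
Proof.
by move=> T1; exists 1 => x; rewrite !rnormE -rmorphM lecR mul1r.
Qed.

Section completed_family.
Variables (H : hilbertSpace R) (e v : nat -> H).
Local Notation "''[' x , y ]" := (inner H x y) : ring_scope.

(** The family [v], completed to one with dense span by vectors orthogonal
    to it. *)
Definition completed_family (i : nat + nat) : H :=
  match i with
  | inl j => v j
  | inr k => if `[< forall j, '[v j, e k] = 0 >] then e k else 0
  end.

Hypothesis ve : forall k,
  (exists s, e k = comb v s) \/ (forall i, '[v i, e k] = 0).

Lemma completed_family_dense : dense_span e -> dense_span completed_family.
Proof.
move=> /dense_span_trans; apply=> k; have [[s ->]|vek] := ve k.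
  exists [seq (p.1, inl p.2) | p <- s].
  by rewrite /comb big_map.
exists [:: (1, inr k)]; rewrite comb1 /=.
by case: asboolP.
Qed.

Lemma completed_family_orth j k : '[v j, completed_family (inr k)] = 0.
Proof. by rewrite /=; case: asboolP => // _; rewrite inner0r. Qed.

(** The extension vanishes on the orthogonal complement of [v]; it remains a
    contraction by Pythagoras. *)
Lemma extend_by_zero (w : nat -> H) :
  dense_span e -> (forall s, rnorm (comb w s) <= rnorm (comb v s)) ->
  exists T : {linear H -> H},
    [/\ forall x, rnorm (T x) <= rnorm x, forall i, T (v i) = w i
      & forall k, T (completed_family (inr k)) = 0].
Proof.
move=> e_dense wv.
pose w' (i : nat + nat) := if i is inl j then w j else 0.
have split_comb s : exists t z, [/\ comb completed_family s = comb v t + z,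
    comb w' s = comb w t & forall j, '[v j, z] = 0].
  elim: s => [|[a [i|k]] s [t [z [Ev Ew z0]]]].
  - by exists [::], 0; split=> [||j]; rewrite ?comb_nil ?addr0 ?inner0r.
  - exists ((a, i) :: t), z; split=> //.
      by rewrite [in LHS]/comb big_cons -/(comb _ _) Ev addrA /comb big_cons.
    by rewrite [in LHS]/comb big_cons -/(comb _ _) Ew /comb big_cons.
  - exists t, (a *: completed_family (inr k) + z); split=> [||j].
    + by rewrite [in LHS]/comb big_cons -/(comb _ _) Ev addrCA.
    + by rewrite [in LHS]/comb big_cons -/(comb _ _) Ew scaler0 add0r.
    + by rewrite innerDr innerZr completed_family_orth mulr0 z0 addr0.
have [|T [T1 Tw]] := @extend_contraction R H H _ completed_family w'
    (completed_family_dense e_dense).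
  move=> s; have [t [z [-> -> z0]]] := split_comb s.
  apply: le_trans (wv t) _.
  have vz : '[comb v t, z] = 0.
    by rewrite inner_suml big1 // => p _; rewrite innerZl z0 mulr0.
  rewrite -ler_sqr ?nnegrE ?rnorm_ge0 // -lecR -!inner_rnorm.
  rewrite innerDl !innerDr vz -[ '[z, comb _ _]]inner_conj vz conjC0 addr0 add0r.
  by rewrite lerDl inner_rnorm ler0c sqr_ge0.
by exists T; split=> // i; rewrite ?(Tw (inl i)) ?(Tw (inr i)).
Qed.

End completed_family.

(** If [v i] are vectors with Gram matrix [G], then [v i |-> v (s i)] and
    [v i |-> v (t i)] are contractions by the two comparisons of kernels, adjoint
    to each other by [G (s i) j = G i (t j)], and they commute as [s] and [t] do. *)
Lemma normal_of_commuting_shifts (H : hilbertSpace R) (e : nat -> H)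
    (G : nat -> nat -> R) (s t : nat -> nat) :
  (forall m n, inner H (e m) (e n) = (m == n)%:R) -> dense_span e ->
  (forall i j, G i j = G j i) -> psd_kernel G ->
  (forall i, s (t i) = t (s i)) ->
  (forall i j, G (s i) j = G i (t j)) ->
  psd_kernel (fun i j => G i j - G (s i) (s j)) ->
  psd_kernel (fun i j => G i j - G (t i) (t j)) ->
  exists (v : nat -> H) (N : {linear H -> H}),
    [/\ forall i j, inner H (v i) (v j) = (G i j)%:C, normal_op N
      & forall i, N (v i) = v (s i)].
Proof.
move=> e_on e_dense G_sym G_psd st Gst Gs Gt.
have [v [vG ve]] := gram_vectors e_on G_sym G_psd.
have shift (r : nat -> nat) : psd_kernel (fun i j => G i j - G (r i) (r j)) ->
    exists T : {linear H -> H},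
    [/\ forall x, rnorm (T x) <= rnorm x, forall i, T (v i) = v (r i)
      & forall k, T (completed_family e v (inr k)) = 0].
  move=> Gr; apply: (extend_by_zero ve e_dense).
  exact: (gram_contraction (G := G) (G' := fun i j => G (r i) (r j))).
have [N [N1 Nv N0]] := shift _ Gs; have [S [S1 Sv S0]] := shift _ Gt.
have w_dense := completed_family_dense ve e_dense.
exists v, N; split=> //; split; first exact: contraction_bounded.
exists S; split; first exact: contraction_bounded.
  have orth j k : inner H (completed_family e v (inr k)) (v j) = 0.
    by rewrite -inner_conj completed_family_orth conjC0.
  apply: (dense_span_form_eq (A := N) (A' := idfun) (B := idfun) (B' := S) w_dense)
    => //.
  move=> [i|i] [j|j].
  - by rewrite [completed_family _ _ _]/= /= Nv Sv !vG Gst.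
  - by rewrite S0 [completed_family _ _ (inl _)]/= Nv completed_family_orth inner0r.
  - by rewrite N0 [completed_family _ _ (inl _)]/= Sv orth inner0l.
  - by rewrite N0 S0 inner0l inner0r.
move=> x; apply/eqP; rewrite -subr_eq0; apply/eqP; move: x.
apply: (dense_span_linear_eq0 (f := fun x => N (S x) - S (N x)) (M := 2) w_dense).
- by move=> a x y; rewrite !(linearD, linearZ) addrACA.
- move=> x; apply: le_trans (rnormB _ _) _; rewrite mulrDl mul1r.
  by apply: lerD; [apply: le_trans (N1 _) _|apply: le_trans (S1 _) _].
- move=> [i|k]; first by rewrite /= Nv Sv Nv Sv st subrr.
  by rewrite N0 S0 !linear0 addr0.
Qed.

End normal_operators.

(** * The monomials in a space with a diagonal kernel *)

Section monomials.
Variable R : realType.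
Local Notation C := R[i].
Variables (c : nat -> R) (K : C -> C -> C) (H : rkhs K).
Local Notation "''[' x , y ]" := (inner H x y) : ring_scope.
Local Open Scope classical_set_scope.

Lemma reproducing_vectors : exists kappa : C -> H, forall w, unit_disc w ->
  (forall z, unit_disc z -> fun_of (kappa w) z = K z w) /\
  (forall f : H, fun_of f w = '[f, kappa w]).
Proof.
have /choice[kappa kappaP] w : exists k : H, unit_disc w ->
    (forall z, unit_disc z -> fun_of k z = K z w) /\
    (forall f : H, fun_of f w = '[f, k]).
  have [/(rkhs_reproducing H)[k kP]|nw] := pselect (unit_disc w); first by exists k.
  by exists 0.
by exists kappa.
Qed.

Hypothesis c_gt0 : forall k, 0 < c k.
Variable M : R.
Hypothesis c_growth : forall k, c k <= M * 2 ^+ k.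
Hypothesis K_expansion : diagonal_expansion c K.

(** For [r <= 1 / 4] the terms [c k * r^k] are dominated by [M * (2 * r)^k], a
    geometric series of ratio at most [1 / 2]. *)
Lemma kernel_tail n : exists2 B : R, 0 <= B &
  forall z w, unit_disc z -> unit_disc w -> rnorm (z * Num.conj w) <= 4^-1 ->
  rnorm (K z w - \sum_(k < n) (c k)%:C * (z * Num.conj w) ^+ k
    - (c n)%:C * (z * Num.conj w) ^+ n) <= B * rnorm (z * Num.conj w) ^+ n.+1.
Proof.
have M_ge0 : 0 <= M.
  by have := c_growth 0; rewrite expr0 mulr1; apply: le_trans; rewrite ltW.
exists (M * 2 ^+ n.+2) => [|z w zD wD]; first by rewrite mulr_ge0 ?exprn_ge0.
set x := z * _ => x4; apply/ler_addgt0Pl => e e_gt0.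
have eC : 0 < e%:C :> C by rewrite ltcR.
have [N _ KN] : \forall N \near \oo,
    `|K z w - series (fun k => (c k)%:C * x ^+ k) N| < e%:C.
  by apply: cvgr_dist_lt => //; exact: K_expansion.
pose J := (maxn N n.+1)%N.
have := KN J (leq_maxl _ _); rewrite /= rnormE ltcR => KJ.
rewrite -addrA -opprD -[_ + _ * _](@big_ord_recr _ _ _ n (fun k => (c k)%:C * x ^+ k)).
rewrite -(subrKA (series (fun k => (c k)%:C * x ^+ k) J)).
apply: le_trans (rnormD _ _) _; rewrite lerD ?(ltW KJ) //.
rewrite /series /= (@big_cat_nat _ _ _ n.+1) ?leq_maxr //= big_mkord addrAC subrr add0r.
have half_sum m : \sum_(j < m) (2^-1 : R) ^+ j <= 2.
  suff -> : \sum_(j < m) (2^-1 : R) ^+ j = 2 - 2 * 2^-1 ^+ m.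
    by rewrite gerBl mulr_ge0 ?exprn_ge0.
  elim: m => [|m IHm]; first by rewrite big_ord0 expr0 mulr1 subrr.
  by rewrite big_ord_recr /= IHm exprS; field.
rewrite -[n.+1 in X in rnorm X]add0n big_addn big_mkord.
have rnorm_sum m (F : 'I_m -> C) : rnorm (\sum_j F j) <= \sum_j rnorm (F j).
  elim/big_ind2: _ => [|p q r s pq rs|//]; first by rewrite rnorm0.
  by apply: le_trans (rnormD _ _) _; rewrite lerD.
apply: le_trans (rnorm_sum _ _) _.
have rnormX k : rnorm (x ^+ k) = rnorm x ^+ k.
  elim: k => [|k IHk]; last by rewrite !exprS rnormM IHk.
  by rewrite !expr0 -(rmorph1 (real_complex R)) rnorm_real normr1.
apply: (@le_trans _ _ (\sum_(j < J - n.+1)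
    M * 2 ^+ n.+1 * rnorm x ^+ n.+1 * 2^-1 ^+ j)).
  apply: ler_sum => j _; rewrite rnormM rnorm_real gtr0_norm // rnormX.
  apply: (@le_trans _ _ (M * 2 ^+ (j + n.+1) * rnorm x ^+ (j + n.+1))).
    by rewrite ler_wpM2r ?exprn_ge0 ?rnorm_ge0.
  have -> : M * 2 ^+ (j + n.+1) * rnorm x ^+ (j + n.+1) =
      M * 2 ^+ n.+1 * rnorm x ^+ n.+1 * (2 * rnorm x) ^+ j.
    by rewrite exprMn !exprD; ring.
  rewrite ler_wpM2l //.
    by rewrite !mulr_ge0 ?exprn_ge0 ?rnorm_ge0.
  rewrite lerXn2r ?nnegrE ?mulr_ge0 ?rnorm_ge0 //; lra.
rewrite -mulr_sumr.
have -> : M * 2 ^+ n.+2 * rnorm x ^+ n.+1 = M * 2 ^+ n.+1 * rnorm x ^+ n.+1 * 2.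
  by rewrite (exprS _ n.+1); ring.
by rewrite ler_wpM2l // !mulr_ge0 ?exprn_ge0 ?rnorm_ge0.
Qed.

Definition monomials n (e : nat -> H) : Prop :=
  (forall k z, (k < n)%N -> unit_disc z -> fun_of (e k) z = z ^+ k) /\
  (forall k l, (k < n)%N -> (l < n)%N ->
     '[e k, e l] = ((c k)^-1 *+ (k == l))%:C).

(** Points of the disc that tend to [0], at which the kernel functions are taken. *)
Definition radius m : R := 4^-1 * harmonic m.

Lemma radius_gt0 m : 0 < radius m.
Proof. by rewrite mulr_gt0 ?invr_gt0 ?ltr0n. Qed.

Lemma radius_le m : radius m <= 4^-1.
Proof.
rewrite -[leRHS]mulr1 ler_wpM2l ?invr_ge0 // /harmonic /=.
by rewrite invf_le1 ?ler1n ?ltr0n.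
Qed.

Lemma radius_mono m p : (m <= p)%N -> radius p <= radius m.
Proof.
move=> mp; rewrite ler_wpM2l ?invr_ge0 // /harmonic /=.
by rewrite lef_pV2 ?posrE ?ltr0n // ler_nat.
Qed.

Lemma cvg_radius A : (fun m => (A * radius m) ^+ 2) @ \oo --> (0 : R).
Proof.
have -> : (0 : R) = (A * (4^-1 * 0)) * (A * (4^-1 * 0)) by rewrite !mulr0.
under eq_fun do rewrite expr2.
by apply: cvgM; do 2!apply: cvgMr; exact: cvg_harmonic.
Qed.

Lemma radius_null (x : C) A : (forall m, rnorm x <= A * radius m) -> x = 0.
Proof.
move=> xA; apply: rnorm_le0_eq0.
have A0 : (fun m => A * radius m) @ \oo --> A * (4^-1 * 0).
  by do 2!apply: cvgMr; exact: cvg_harmonic.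
rewrite !mulr0 in A0; rewrite -(cvg_lim _ A0) //; apply: limr_ge.
  exact: cvgP A0.
exact: nearW.
Qed.

Lemma radius_disc m : unit_disc ((radius m)%:C : C).
Proof.
rewrite /unit_disc /= rnormE ltcR rnorm_real gtr0_norm ?radius_gt0 //.
by apply: le_lt_trans (radius_le m) _; rewrite invf_lt1 ?ltr1n.
Qed.


(** Let [g] be the kernel function at [t] minus its projection on the lower
    monomials.  As a function it is [\sum_(k >= n) c k t^k z^k], so that
    [h = g / (c n * t^n)] tends to [z^n] pointwise.  The reproducing property
    turns inner products of the [h] into values of the kernel, all within
    [O (t m * t p)] of [1 / c n]; hence the [h] form a Cauchy sequence. *)
Lemma monomial_step n (e : nat -> H) : monomials n e ->
  exists f : H, (forall z, unit_disc z -> fun_of f z = z ^+ n) /\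
    '[f, f] = ((c n)^-1)%:C /\ forall k, (k < n)%N -> '[f, e k] = 0.
Proof.
move=> [eE e_orth].
have [kappa kappaP] := reproducing_vectors.
have [B B_ge0 tail] := kernel_tail n.
pose t m := radius m.
have tD m : unit_disc ((t m)%:C : C) := radius_disc m.
have t_gt0 m : 0 < t m := radius_gt0 m.
pose g m : H := kappa (t m)%:C - \sum_(k < n) (c k * t m ^+ k)%:C *: e k.
pose a m : R := c n * t m ^+ n.
have a_gt0 m : 0 < a m by rewrite mulr_gt0 ?exprn_gt0.
pose h m : H := ((a m)^-1)%:C *: g m.
have ge m k : (k < n)%N -> '[g m, e k] = 0.
  move=> kn; rewrite innerBl -inner_conj -(kappaP _ (tD m)).2 eE // rmorphXn /= conj_real.
  rewrite inner_suml (bigD1 (Ordinal kn)) //= innerZl e_orth // eqxx mulr1n.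
  rewrite big1 ?addr0 => [|l lk]; last first.
    by rewrite innerZl e_orth // (negPf (lk : nat_of_ord l != k)) mulr0.
  by rewrite -rmorphM mulrAC divff ?gt_eqF // mul1r rmorphXn subrr.
have gk m z : unit_disc z -> rnorm ('[g m, kappa z] - (a m)%:C * z ^+ n) <=
    B * (t m ^+ n.+1 * rnorm z ^+ n.+1).
  move=> zD.
  have zt : z * Num.conj ((t m)%:C : C) = z * (t m)%:C by rewrite conj_real.
  have rzt : rnorm (z * Num.conj ((t m)%:C : C)) = t m * rnorm z.
    by rewrite zt rnormM rnorm_real gtr0_norm // mulrC.
  have z1 : rnorm z <= 1 by move: zD; rewrite /unit_disc /= rnormE ltcR => /ltW.
  have tz4 : t m * rnorm z <= 4^-1.
    rewrite -[leRHS]mulr1; apply: ler_pM => //; [exact: ltW|exact: rnorm_ge0|].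
    exact: radius_le.
  have := tail z _ zD (tD m); rewrite rzt zt [(t m * _) ^+ _]exprMn => /(_ tz4).
  congr (rnorm (_ - _) <= _).
    rewrite innerBl -(kappaP _ zD).2 (kappaP _ (tD m)).1 // inner_suml; congr (_ - _).
    apply: eq_bigr => k _; rewrite innerZl -(kappaP _ zD).2 eE // exprMn.
    by rewrite [(c k * _)%:C]rmorphM /= rmorphXn /= mulrAC mulrA.
  by rewrite exprMn /a [(c n * _)%:C]rmorphM /= rmorphXn /= mulrAC mulrA.
have gg m p : '[g m, g p] = '[g m, kappa (t p)%:C].
  rewrite {2}/g innerBr inner_sumr big1 ?subr0 // => k _.
  by rewrite innerZr ge // mulr0.
have hk m z : unit_disc z -> rnorm ('[h m, kappa z] - z ^+ n) <=
    B / c n * rnorm z ^+ n.+1 * t m.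
  move=> zD; have -> : '[h m, kappa z] - z ^+ n =
      ((a m)^-1)%:C * ('[g m, kappa z] - (a m)%:C * z ^+ n).
    by rewrite innerZl mulrBr mulrA -rmorphM mulVf ?gt_eqF // mul1r.
  rewrite rnormM rnorm_real gtr0_norm ?invr_gt0 // ler_pdivrMl //.
  apply: le_trans (gk m z zD) _; rewrite /a exprS.
  have -> : c n * t m ^+ n * (B / c n * rnorm z ^+ n.+1 * t m) =
    B * (t m * t m ^+ n * rnorm z ^+ n.+1) * (c n / c n) by ring.
  by rewrite divff ?gt_eqF // mulr1.
have hh m p : rnorm ('[h m, h p] - ((c n)^-1)%:C) <= B / c n ^+ 2 * (t m * t p).
  have -> : '[h m, h p] - ((c n)^-1)%:C =
      ((a p)^-1)%:C * ('[h m, kappa (t p)%:C] - (t p)%:C ^+ n).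
    rewrite {2}/h innerZr conj_real innerZl gg -innerZl -/(h m) mulrBr; congr (_ - _).
    rewrite -rmorphXn -rmorphM /a /=; congr (_%:C).
    by rewrite invfM -mulrA mulVf ?mulr1 // expf_neq0 // gt_eqF.
  rewrite rnormM rnorm_real gtr0_norm ?invr_gt0 // ler_pdivrMl //.
  apply: le_trans (hk m _ (tD p)) _; rewrite rnorm_real gtr0_norm // /a exprS.
  have -> : c n * t p ^+ n * (B / c n ^+ 2 * (t m * t p)) =
    B / c n * (t p * t p ^+ n) * t m * (c n / c n) by rewrite expr2 invfM; ring.
  by rewrite divff ?gt_eqF // mulr1.
pose A := Num.sqrt (4 * (B / c n ^+ 2)).
have A2 : A ^+ 2 = 4 * (B / c n ^+ 2).
  by rewrite sqr_sqrtr // mulr_ge0 // divr_ge0 // sqr_ge0.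
have [||l lh] := @hilbert_complete R H h (fun m => (A * t m) ^+ 2).
- exact: cvg_radius.
- move=> m p mp; rewrite -[leLHS]ger0_norm ?sqr_ge0 // -rnorm_real -inner_rnorm.
  have -> : '[h p - h m, h p - h m] =
      ('[h p, h p] - ((c n)^-1)%:C) - ('[h p, h m] - ((c n)^-1)%:C)
      - (('[h m, h p] - ((c n)^-1)%:C) - ('[h m, h m] - ((c n)^-1)%:C)).
    by rewrite innerBl !innerBr; ring.
  have bound q r : (m <= q)%N -> (m <= r)%N ->
      rnorm ('[h q, h r] - ((c n)^-1)%:C) <= B / c n ^+ 2 * t m ^+ 2.
    move=> mq mr; apply: le_trans (hh q r) _; rewrite ler_wpM2l ?divr_ge0 ?sqr_ge0 //.
    by rewrite expr2 ler_pM ?radius_mono // ltW.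
  rewrite exprMn A2; apply: le_trans (rnormB _ _) _.
  have := rnormB ('[h p, h p] - ((c n)^-1)%:C) ('[h p, h m] - ((c n)^-1)%:C).
  have := rnormB ('[h m, h p] - ((c n)^-1)%:C) ('[h m, h m] - ((c n)^-1)%:C).
  have := bound p p mp mp; have := bound p m mp (leqnn m).
  have := bound m p (leqnn m) mp; have := bound m m (leqnn m) (leqnn m).
  by rewrite -mulrA; lra.
have {}lh m : rnorm (l - h m) <= A * t m.
  have At_ge0 : 0 <= A * t m by rewrite mulr_ge0 ?sqrtr_ge0 ?ltW.
  by rewrite -ler_sqr ?nnegrE ?rnorm_ge0.
have inner_close x m : rnorm ('[l, x] - '[h m, x]) <= A * rnorm x * t m.
  rewrite -innerBl; apply: le_trans (cauchy_schwarz _ _) _.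
  by rewrite mulrAC ler_wpM2r ?rnorm_ge0.
have le k : (k < n)%N -> '[l, e k] = 0.
  move=> kn; apply: (@radius_null _ (A * rnorm (e k))) => m.
  by have := inner_close (e k) m; rewrite innerZl ge // mulr0 subr0.
have lE z : unit_disc z -> fun_of l z = z ^+ n.
  move=> zD; rewrite (kappaP _ zD).2; apply/eqP; rewrite -subr_eq0; apply/eqP.
  apply: (@radius_null _ (A * rnorm (kappa z) + B / c n * rnorm z ^+ n.+1)) => m.
  rewrite -(subrKA '[h m, kappa z]) mulrDl; apply: le_trans (rnormD _ _) _.
  by rewrite lerD ?hk.
exists l; split=> //; split=> //.
apply/eqP; rewrite -subr_eq0; apply/eqP.
apply: (@radius_null _ (A * rnorm l)) => m.
suff <- : '[h m, l] = ((c n)^-1)%:C by exact: inner_close.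
have gl : '[l, g m] = (t m)%:C ^+ n.
  rewrite innerBr -(kappaP _ (tD m)).2 lE // inner_sumr big1 ?subr0 // => k _.
  by rewrite innerZr le // mulr0.
rewrite innerZl -inner_conj gl rmorphXn /= conj_real -rmorphXn -rmorphM /=.
by congr (_%:C); rewrite /a invfM -mulrA mulVf ?mulr1 // expf_neq0 // gt_eqF.
Qed.

End monomials.

Section monomial_basis.
Variable R : realType.
Local Notation C := R[i].
Variables (c : nat -> R) (K : C -> C -> C) (H : rkhs K).
Local Notation "''[' x , y ]" := (inner H x y) : ring_scope.
Local Open Scope classical_set_scope.
Hypothesis c_gt0 : forall k, 0 < c k.
Variable M : R.
Hypothesis c_growth : forall k, c k <= M * 2 ^+ k.
Hypothesis K_expansion : diagonal_expansion c K.

Lemma monomials_exist : exists e : nat -> H, forall n, monomials c n e.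
Proof.
have finite n : exists e : nat -> H, monomials c n e.
  elim: n => [|n [e en]]; first by exists (fun=> 0); split.
  have [f [fE [ff fe]]] := monomial_step c_gt0 c_growth K_expansion en.
  exists (fun k => if (k < n)%N then e k else f); split=> [k z|k l]; rewrite !ltnS.
    rewrite leq_eqVlt => /predU1P[->|kn] zD; first by rewrite ltnn fE.
    by rewrite kn en.1.
  have [kn _|nk kn] := ltnP k n; have [ln _|nl ln] := ltnP l n.
  - exact: en.2.
  - by rewrite -inner_conj fe // conjC0 ltn_eqF // (leq_trans kn).
  - by rewrite fe // gtn_eqF // (leq_trans ln).
  - have /eqP-> : k == n by rewrite eqn_leq kn nk.
    have /eqP-> : l == n by rewrite eqn_leq ln nl.
    by rewrite ff eqxx.
have [e en] := choice finite.
pose f k := e k.+1 k.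
have fE k n : (k < n)%N -> f k = e n k.
  move=> kn; apply: fun_of_inj => z zD.
  by rewrite (en k.+1).1 // (en n).1.
exists f => n; split=> [k z kn|k l kn ln].
  by rewrite (fE k n) //; apply: (en n).1.
by rewrite (fE k n) // (fE l n) //; apply: (en n).2.
Qed.

(** The kernel functions are limits of combinations of monomials: the square of
    the distance is the remainder of the expansion of [K z z].  So a vector
    orthogonal to the monomials takes the value [0] at each point. *)
Lemma monomials_complete e x : (forall n, monomials c n e) ->
  (forall k, '[x, e k] = 0) -> x = 0.
Proof.
move=> emon xe; have [kappa kappaP] := reproducing_vectors H.
have eE k z : unit_disc z -> fun_of (e k) z = z ^+ k.
  exact: (emon k.+1).1.
have e_orth k l : '[e k, e l] = ((c k)^-1 *+ (k == l))%:C.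
  by apply: (emon (maxn k l).+1).2; rewrite ltnS ?leq_maxl ?leq_maxr.
apply: fun_of_inj => z zD; rewrite !(kappaP _ zD).2 inner0l.
pose p n := \sum_(0 <= k < n) ((c k)%:C * Num.conj z ^+ k) *: e k.
have dist_sq n : '[kappa z - p n, kappa z - p n] =
    K z z - series (fun k => (c k)%:C * (z * Num.conj z) ^+ k) n.
  have orth k : (k < n)%N -> '[kappa z - p n, e k] = 0.
    move=> kn; rewrite innerBl -inner_conj -(kappaP _ zD).2 eE //.
    rewrite inner_suml (bigD1_seq k) ?mem_index_iota ?iota_uniq //=.
    rewrite innerZl e_orth eqxx big1 ?addr0 => [|l lk]; last first.
      by rewrite innerZl e_orth (negPf lk) mulr0.
    rewrite mulr1n mulrAC -rmorphM divff ?gt_eqF // mul1r.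
    by rewrite rmorphXn subrr.
  rewrite {2}/p innerBr inner_sumr [X in _ - X]big_nat_cond big1 ?subr0; last first.
    by move=> k /andP[/andP[_ kn] _]; rewrite innerZr orth // mulr0.
  rewrite innerBl -(kappaP _ zD).2 (kappaP _ zD).1 // inner_suml; congr (_ - _).
  apply: eq_bigr => k _; rewrite innerZl -(kappaP _ zD).2 eE // exprMn; ring.
have inner_p n : '[x, p n] = 0.
  by rewrite inner_sumr big1 // => k _; rewrite innerZr xe mulr0.
apply: rnorm_le0_eq0; apply/ler_addgt0Pl => eps eps_gt0; rewrite addr0.
have x1_gt0 : 0 < rnorm x + 1 by rewrite ltr_wpDl ?rnorm_ge0.
pose d := eps / (rnorm x + 1); have d_gt0 : 0 < d by rewrite divr_gt0.
have dC : 0 < (d ^+ 2)%:C :> C by rewrite ltcR exprn_gt0.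
have [N _ KN] : \forall N \near \oo,
    `|K z z - series (fun k => (c k)%:C * (z * Num.conj z) ^+ k) N| < (d ^+ 2)%:C.
  by apply: cvgr_dist_lt => //; exact: K_expansion.
have := KN N (leqnn N); rewrite /= -dist_sq rnormE ltcR inner_rnorm rnorm_real.
rewrite ger0_norm ?sqr_ge0 // ltr_sqr ?nnegrE ?rnorm_ge0 ?(ltW d_gt0) // => kd.
have -> : '[x, kappa z] = '[x, kappa z - p N] by rewrite innerBr inner_p subr0.
apply: le_trans (cauchy_schwarz _ _) _.
have <- : (rnorm x + 1) * d = eps by rewrite /d mulrC divfK ?gt_eqF.
by rewrite ler_pM ?rnorm_ge0 ?(ltW kd) // lerDl.
Qed.

Lemma normalized_monomials e : (forall n, monomials c n e) ->
  let f k := (Num.sqrt (c k))%:C *: e k in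
  [/\ forall m n, '[f m, f n] = (m == n)%:R, dense_span f & dense_span e].
Proof.
move=> emon f.
have e_orth k l : '[e k, e l] = ((c k)^-1 *+ (k == l))%:C.
  by apply: (emon (maxn k l).+1).2; rewrite ltnS ?leq_maxl ?leq_maxr.
have f_on m n : '[f m, f n] = (m == n)%:R.
  rewrite innerZl innerZr conj_real e_orth; have [->|_] := eqVneq; last first.
    by rewrite !mulr0.
  rewrite mulr1n mulrA -!rmorphM -expr2 sqr_sqrtr ?ltW // divff ?gt_eqF //.
have sqrt_neq0 k : (Num.sqrt (c k))%:C != 0 :> C.
  by rewrite fmorph_eq0 sqrtr_eq0 -ltNge.
have f_dense : dense_span f.
  apply: (orthonormal_dense_span f_on) => x xf.
  apply: (monomials_complete emon) => k; have := xf k.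
  move/eqP; rewrite innerZr conj_real mulf_eq0 (negPf (sqrt_neq0 k)) /=.
  by move/eqP.
split=> //; apply: (dense_span_trans f_dense) => k.
by exists [:: ((Num.sqrt (c k))%:C, k)]; rewrite /comb big_seq1.
Qed.

End monomial_basis.

(** * Completely alternating sequences *)

Section alternating.
Variable R : realType.

Lemma completely_alternating_diff (a : nat -> R) n m :
  completely_alternating a -> iter n.+1 altdiff a m <= 0.
Proof. by move=> [_ a_alt]; rewrite iter_diffE; apply: a_alt. Qed.

(** The second difference makes [c] concave, so every step after the first at most
    doubles it. *)
Lemma completely_alternating_growth (c : nat -> R) :
  (forall k, 0 < c k) -> (forall n m, iter n.+1 altdiff c m <= 0) ->
  forall k, c k <= (c 0 + c 1) * 2 ^+ k.
Proof.
move=> c_gt0 c_alt.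
suff H k : c k <= (c 0 + c 1) * 2 ^+ k /\ c k.+1 <= (c 0 + c 1) * 2 ^+ k.+1.
  by move=> k; have [] := H k.
have := c_gt0 0; have := c_gt0 1; move=> c1 c0.
elim: k => [|k [IH1 IH2]]; first by rewrite expr0 expr1; lra.
split=> //; rewrite exprS mulrCA.
have := c_alt 1 k; rewrite /= /altdiff; have := c_gt0 k; lra.
Qed.

End alternating.

(** * Subnormality of the weighted shift *)

Section weighted_shifts.
Variable R : realType.
Variables (H : hilbertSpace R) (e f : nat -> H) (g : nat -> R).
Hypothesis f_on : forall m n, inner H (f m) (f n) = (m == n)%:R.
Hypothesis f_dense : dense_span f.
Hypothesis e_dense : dense_span e.
Hypothesis e_orth : forall k l, inner H (e k) (e l) = (g k *+ (k == l))%:C.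
Hypothesis g_mono : completely_monotone g.

Let diag_sym (h : nat -> R) k l : h k *+ (k == l) = h l *+ (l == k).
Proof. by rewrite eq_sym; case: eqP => [->|]. Qed.

Lemma weighted_shift_exists : exists T : {linear H -> H},
  (forall x, rnorm (T x) <= rnorm x) /\ forall k, T (e k) = e k.+1.
Proof.
apply: (extend_contraction e_dense).
apply: (gram_contraction (G := fun k l => g k *+ (k == l))
  (G' := fun k l => g k.+1 *+ (k == l))) => [||//|k l|].
- exact: diag_sym.
- exact: (diag_sym (fun k => g k.+1)).
- by rewrite e_orth eqSS.
- have := psd_comp (fun k => (k, 0)%N)
    (psd_moment_kernel (completely_monotone_diff g_mono)).
  congr (psd_kernel _); apply/funext => k; apply/funext => l.
  by rewrite /moment_kernel /= !addn0 -mulrnBl.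
Qed.

(** [H] itself is used as the larger space: it contains vectors [v (i, j)]
    behaving like [z^i (conj z)^j], the isometry sends [e k] to the copy
    [v (k, 0)] of [z^k], and the normal operator is the shift of the index [i]. *)
Lemma weighted_shift_subnormal (T : {linear H -> H}) :
  (forall x, rnorm (T x) <= rnorm x) -> (forall k, T (e k) = e k.+1) ->
  subnormal T.
Proof.
move=> T1 Te; split; first exact: contraction_bounded.
have [phi phiK] : exists phi : nat -> nat * nat, cancel pickle phi.
  by exists (fun n => odflt (0, 0)%N (unpickle n)) => i; rewrite pickleK.
  (* The pairs are coded by integers because Gram vectors are built along an
     enumeration; [s] and [t] are multiplication by [z] and by [conj z]. *)
pose s n := pickle ((phi n).1.+1, (phi n).2).
pose t n := pickle ((phi n).1, (phi n).2.+1).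
pose G i j := moment_kernel g (phi i) (phi j).
have G_shift (r : nat -> nat) :
    (forall i j, G (r i) (r j) = g ((phi i).1 + (phi j).2).+1 *+
       ((phi i).1 + (phi j).2 == (phi j).1 + (phi i).2)%N) ->
    psd_kernel (fun i j => G i j - G (r i) (r j)).
  move=> rE.
  have := psd_comp phi (psd_moment_kernel (completely_monotone_diff g_mono)).
  congr (psd_kernel _); apply/funext => i; apply/funext => j.
  by rewrite rE /G /moment_kernel /altdiff mulrnBl.
have [||||||v [N [vG N_normal Nv]]] :=
    @normal_of_commuting_shifts R H _ G s t f_on f_dense.
- by move=> i j; exact: moment_kernel_sym.
- exact: (psd_comp phi (psd_moment_kernel g_mono)).
- by move=> i; rewrite /s /t !phiK.
- by move=> i j; rewrite /G /s /t /moment_kernel !phiK /= addnS addSn.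
- by apply: G_shift => i j; rewrite /G /s /moment_kernel !phiK /= !addSn eqSS.
- by apply: G_shift => i j; rewrite /G /t /moment_kernel !phiK /= !addnS eqSS.
have v_orth k l :
    inner H (v (pickle (k, 0)%N)) (v (pickle (l, 0)%N)) = (g k *+ (k == l))%:C.
  by rewrite vG /G !phiK /moment_kernel /= !addn0.
have [V [V1 Ve]] : exists V : {linear H -> H},
    (forall x, rnorm (V x) <= rnorm x) /\ forall k, V (e k) = v (pickle (k, 0)%N).
  apply: (extend_contraction e_dense).
  apply: (gram_contraction (G := fun k l => g k *+ (k == l))
    (G' := fun k l => g k *+ (k == l))) => [||//|//|r].
  - exact: diag_sym.
  - exact: diag_sym.
  - by rewrite big1 // => p _; rewrite big1 // => q _; rewrite subrr mulr0.
exists H, V, N; split=> //.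
- apply: (dense_span_form_eq (A := V) (A' := V) (B := idfun) (B' := idfun) e_dense)
    => // k l.
  by rewrite !Ve v_orth e_orth.
- move=> x; apply/eqP; rewrite -subr_eq0; apply/eqP; move: x.
  have [B NB] := N_normal.1.
  apply: (dense_span_linear_eq0 (f := fun x => N (V x) - V (T x)) (M := `|B| + 1) e_dense).
  + by move=> x y z; rewrite !(linearD, linearZ) addrACA.
  + move=> x; apply: le_trans (rnormB _ _) _; rewrite mulrDl mul1r lerD //.
      have := NB (V x); rewrite !rnormE -rmorphM lecR => /le_trans; apply.
      apply: (@le_trans _ _ (`|B| * rnorm (V x))).
        by rewrite ler_wpM2r ?rnorm_ge0 ?ler_norm.
      by rewrite ler_wpM2l.
    exact: le_trans (V1 _) _.
  + by move=> k; rewrite Te !Ve Nv /s phiK subrr.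
Qed.

End weighted_shifts.

Lemma shift_is_mult_z (R : realType) (K : R[i] -> R[i] -> R[i]) (H : rkhs K)
    (e : nat -> H) (T : {linear H -> H}) :
  dense_span e -> (forall k z, unit_disc z -> fun_of (e k) z = z ^+ k) ->
  (forall x, rnorm (T x) <= rnorm x) -> (forall k, T (e k) = e k.+1) ->
  is_mult_z T.
Proof.
move=> e_dense eE T1 Te f z zD; have [kappa kappaP] := reproducing_vectors H.
rewrite !(kappaP _ zD).2; apply/eqP; rewrite -subr_eq0; apply/eqP.
move: f; apply: (dense_span_linear_eq0
  (M := rnorm (kappa z) + rnorm z * rnorm (kappa z))
  (f := fun f => inner H (T f) (kappa z) - z * inner H f (kappa z)) e_dense).
- by move=> x f h; rewrite (linearP T) !innerDl !innerZl /GRing.scale /=; ring.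
- move=> f; apply: le_trans (rnormB _ _) _; rewrite rnormM mulrDl -mulrA.
  apply: lerD; first apply: le_trans (cauchy_schwarz _ _) _.
    by rewrite mulrC ler_wpM2l ?rnorm_ge0.
  by rewrite ler_wpM2l ?rnorm_ge0 // mulrC cauchy_schwarz.
- by move=> k; rewrite Te -!(kappaP _ zD).2 !eE // exprS subrr.
Qed.

Theorem corollary2p7 (R : realType) (a b : nat -> R)
    (K1 K2 : R[i] -> R[i] -> R[i])
    (K1_kernel : reproducing_kernel K1) (K2_kernel : reproducing_kernel K2)
    (K1_expansion : diagonal_expansion a K1)
    (K2_expansion : diagonal_expansion b K2)
    (a_alternating : completely_alternating a)
    (b_alternating : completely_alternating b)
    (H : rkhs (fun z w => K1 z w + K2 z w)) :
  exists Mz : {linear H -> H}, is_mult_z Mz /\ subnormal Mz.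
Proof.
pose c k := a k + b k.
have c_gt0 k : 0 < c k by rewrite addr_gt0 // (a_alternating.1, b_alternating.1).
have c_alt n m : iter n.+1 altdiff c m <= 0.
  by rewrite iter_diffD -[leRHS]addr0 lerD // completely_alternating_diff.
have c_growth := completely_alternating_growth c_gt0 c_alt.
have K_expansion : diagonal_expansion c (fun z w => K1 z w + K2 z w).
  move=> z w zD wD.
  have -> : (fun k => (c k)%:C * (z * Num.conj w) ^+ k) =
      (fun k => (a k)%:C * (z * Num.conj w) ^+ k) \+
      (fun k => (b k)%:C * (z * Num.conj w) ^+ k).
    by apply/funext => k /=; rewrite rmorphD mulrDl.
  by rewrite seriesD; apply: cvgD; [exact: K1_expansion|exact: K2_expansion].
have [e emon] := monomials_exist H c_gt0 c_growth K_expansion.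
have [f_on f_dense e_dense] := normalized_monomials c_gt0 K_expansion emon.
have e_orth k l : inner H (e k) (e l) = ((c k)^-1 *+ (k == l))%:C.
  by apply: (emon (maxn k l).+1).2; rewrite ltnS ?leq_maxl ?leq_maxr.
have g_mono := completely_monotone_inv c_gt0 c_alt.
have [Mz [Mz1 MzE]] := weighted_shift_exists e_dense e_orth g_mono.
exists Mz; split; last exact: (weighted_shift_subnormal f_on f_dense e_dense e_orth).
by apply: (shift_is_mult_z e_dense) => // k z zD; apply: (emon k.+1).1.
Qed.
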